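(* Let $\mathcal{X}$ be a discrete-time birth-death process on $S=\{0,1,2,\dots\}$ with birth, death and self-transition probabilities $p_i>0$, $q_{i+1}>0$, $r_i\ge 0$ ($i\ge 0$), where $q_0=0$, $p_i+q_i+r_i=1$ for all $i\ge 0$, and $r_i>0$ for at least one $i$. Then the asymptotic period $d(\mathcal{X})$ equals $1$, $2$, or $\infty$.
   Context: The birth-death process $\mathcal{X}=\{X(n),\,n=0,1,\dots\}$ is the homogeneous Markov chain on $S=\{0,1,2,\dots\}$ with 1-step transition probabilities $P(i,i+1)=p_i$, $P(i+1,i)=q_{i+1}$, $P(i,i)=r_i$ ($i\ge0$) and all others zero; it is stochastic, irreducible and aperiodic. The initial distribution is arbitrary and $\mathbb{P}$ is the induced probability measure on sample paths. For $m\ge 1$, $\mathcal{X}^{(m)}=\{X^{(m)}(n)=X(nm),\ n=0,1,\dots\}$ is the $m$-step chain. For a Markov chain $\mathcal{Y}=\{Y(n)\}$ on $S$ (here $\mathcal{X}$ or some $\mathcal{X}^{(m)}$) and $C\subset S$ let $U(C)=\{Y(n)\in C \text{ for infinitely many } n\}$ and $L(C)=\{Y(n)\in C\text{ for all sufficiently large }n\}$. $C$ is transient (w.r.t. $\mathcal{Y}$) if $\mathbb{P}(U(C))=0$; regular if $\mathbb{P}(U(C)\setminus L(C))=0$; almost closed if it is regular and not transient. These notions do not depend on the initial distribution. An almost closed set is atomic if it does not contain two disjoint almost closed subsets, and nonatomic otherwise. Two regular sets are equivalent if their symmetric difference is transient. A Blackwell decomposition of $S$ for $\mathcal{Y}$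 is a finite or countable collection $\{C_1,C_2,\dots\}$ of disjoint almost closed sets such that (i) every $C_i$, except at most one, is atomic; (ii) the nonatomic $C_i$, if present, contains no atomic subsets and consists of transient states; (iii) $\sum_i\mathbb{P}(L(C_i))=1$. By a theorem of Blackwell such a decomposition exists and is unique up to equivalence; $\beta(\mathcal{Y})$ denotes the number of sets in it. $\mathcal{Y}$ is simple if $\beta(\mathcal{Y})=1$. (A birth-death process on $S=\{0,1,2,\dots\}$ with birth, death and self-transition probabilities $p_i>0$, $q_{i+1}>0$, $r_i\ge 0$ ($i\ge 0$), where $q_0=0$, $p_i+q_i+r_i=1$ for all $i\ge 0$, and $r_i>0$ for at least one $i$, is simple.) The asymptotic period of a simple chain $\mathcal{X}$ is $d(\mathcal{X}):=\sup\{m\ge1 : \beta(\mathcal{X}^{(m)})=m\}\in\{1,2,\dots\}\cup\{\infty\}$. *)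

(* Defs.v *)
From HB Require Import structures.
From mathcomp Require Export all_boot all_order all_algebra.
From mathcomp Require Export all_classical all_reals all_analysis.

Set Implicit Arguments.
Unset Strict Implicit.
Unset Printing Implicit Defensive.

Import Order.TTheory GRing.Theory Num.Theory.

Local Open Scope classical_set_scope.
Local Open Scope ring_scope.

(* A process on S = {0, 1, 2, ...} is a sequence of random variables with
   values in nat (where every subset is measurable), over an arbitrary
   probability space; its initial law, the law of Y 0, is unconstrained. *)
Section processes.
Context {d : measure_display} {T : measurableType d} {R : realType}.
Context {P : probability T R}.
Implicit Types (Y : nat -> {RV P >-> nat}) (C D : set nat) (B : set (set nat)).

(* P(Y_{n+1} = x_{n+1} | Y_0 = x_0, ..., Y_n = x_n) = K(x_n, x_{n+1}), with the
   conditional probability multiplied out so that null histories need no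
   separate treatment. *)
Definition markov_chain (K : nat -> nat -> R) Y : Prop :=
  forall (n : nat) (x : nat -> nat),
    P [set w | forall k, (k <= n.+1)%N -> Y k w = x k] =
    (P [set w | forall k, (k <= n)%N -> Y k w = x k] *
      (K (x n) (x n.+1))%:E)%E.

Definition mstep (m : nat) Y : nat -> {RV P >-> nat} := fun n => Y (n * m)%N.

Definition U_ev Y C : set T :=
  [set w | forall N, exists2 n, (N <= n)%N & C (Y n w)].

Definition L_ev Y C : set T :=
  [set w | exists N, forall n, (N <= n)%N -> C (Y n w)].

Definition transient Y C : Prop := P (U_ev Y C) = 0%E.

Definition regular Y C : Prop := P (U_ev Y C `\` L_ev Y C) = 0%E.

Definition almost_closed Y C : Prop := regular Y C /\ ~ transient Y C.

Definition atomic Y C : Prop :=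
  almost_closed Y C /\
  ~ (exists D1 D2 : set nat,
      [/\ D1 `<=` C, D2 `<=` C, D1 `&` D2 = set0,
          almost_closed Y D1 & almost_closed Y D2]).

Definition nonatomic Y C : Prop := almost_closed Y C /\ ~ atomic Y C.

(* Almost closed sets are nonempty, so disjoint members of the collection are
   distinct and the collection can be encoded as a set of sets. *)
Record blackwell_decomposition Y B : Prop := BlackwellDecomposition {
  bd_countable : countable B ;
  bd_disjoint : trivIset B id ;
  bd_almost_closed : forall C, B C -> almost_closed Y C ;
  bd_one_nonatomic : forall C D,
    B C -> B D -> nonatomic Y C -> nonatomic Y D -> C = D ;
  bd_nonatomic : forall C, B C -> nonatomic Y C ->
    ~ (exists2 D, D `<=` C & atomic Y D) /\
    (forall i, C i -> transient Y [set i]) ;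
  bd_total : (\esum_(C in B) P (L_ev Y C) = 1)%E }.

(* The number of sets in a Blackwell decomposition, possibly +oo.  The
   decomposition is a chosen one; decompositions exist and are unique up to
   equivalence, so its cardinality does not depend on the choice. *)
Definition beta Y : \bar R :=
  counting (xget set0 [set B | blackwell_decomposition Y B]).

Definition asymptotic_period Y : \bar R :=
  ereal_sup [set (m%:R)%:E | m in
    [set m : nat | (1 <= m)%N /\ beta (mstep m Y) = (m%:R)%:E]].

End processes.

Definition birth_death {R : realType} (p q r : nat -> R) (i j : nat) : R :=
  if j == i.+1 then p i
  else if i == j.+1 then q i
  else if i == j then r i
  else 0.

(* Main.v *)
From mathcomp Require Import ring lra zify.
Require Import Defs.

Set Implicit Arguments.
Unset Strict Implicit.
Unset Printing Implicit Defensive.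

Import Order.TTheory GRing.Theory Num.Theory.
Import numFieldNormedType.Exports.

Local Open Scope classical_set_scope.
Local Open Scope ring_scope.

(* Almost every path is unbounded with steps in {-1, 0, 1}, so from any time on
   it visits every state above its current one.  Hence a regular set is finite
   or cofinite, and beta(X) = 1.

   Suppose beta(X^(m)) = m with m >= 3, let C_k be the m almost closed sets and
   h_k(t, i) the probability, starting from i at time t, that X(nm) ends up in
   C_k; h_k is harmonic and m-periodic in t.  By Levy's 0-1 law every large
   state i is visited with h_k close to 1; as the m residues of the time are
   shared among m sets, h_k(., i) is close to 1 at exactly one residue s(i) and
   close to 0 at the others.  Harmonicity then forces s(i + 1) = s(i) + 1 or
   s(i - 1) = s(i) + 1.  Since 1 and -1 differ mod m, one of the two holds for
   all large i.  The second makes h_k reach the value 1, which the minimum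
   principle excludes.  The first makes the products of the p_i bounded below,
   so that X eventually climbs at every step, and then for every M the residue
   classes mod M are the atoms of X^(M): beta(X^(M)) = M and d(X) is infinite. *)

(** * Combinatorial preliminaries *)

Lemma finite_nat_bounded (D : set nat) : finite_set D ->
  exists N, forall i, D i -> (i <= N)%N.
Proof.
move=> /finite_fsetP[F ->]; exists (\max_(i <- finmap.enum_fset F) i)%N => i /= iF.
exact: leq_bigmax_seq.
Qed.

Lemma infinite_nat_unbounded (D : set nat) N : infinite_set D ->
  exists2 i, D i & (N <= i)%N.
Proof.
move=> iD; apply: contrapT => nD; apply: iD.
apply: (sub_finite_set _ (finite_II N)) => i Di /=.
by rewrite ltnNge; apply/negP => Ni; apply: nD; exists i.
Qed.

(** Go from [i0] to [a], wait there as long as desired, then go on to [i1]: the waiting time absorbs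
    every sufficiently late target time. This is how a loop at [a] yields aperiodicity. *)
Lemma reach (Q : nat -> nat -> Prop) a :
    (forall t i, Q t i -> Q t.+1 i.+1) -> (forall t i, Q t i.+1 -> Q t.+1 i) ->
    (forall t, Q t a -> Q t.+1 a) ->
  forall t0 i0, Q t0 i0 ->
  forall i1, exists t1, forall t, (t1 <= t)%N -> Q t i1.
Proof.
move=> Qu Qd Qa.
have up n t i : Q t i -> Q (t + n)%N (i + n)%N.
  by elim: n => [|n ih]; rewrite ?addn0// !addnS => /ih /Qu.
have down n t i : Q t (i + n)%N -> Q (t + n)%N i.
  by elim: n t => [|n ih] t; rewrite ?addn0// addnS => /Qd /ih; rewrite addSnnS.
have go t i j : exists n, forall u, Q (t + u)%N i -> Q (t + u + n)%N j.
  have [ij|/ltnW ji] := leqP i j.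
    by exists (j - i)%N => u; rewrite -{2}(subnKC ij); exact: up.
  by exists (i - j)%N => u Qu'; apply: down; rewrite subnKC.
move=> t0 i0 Q0 i1; have [n /(_ 0%N)] := go t0 i0 a; rewrite addn0 => /(_ Q0) Qn.
have [k Qk] := go (t0 + n)%N a i1.
exists (t0 + n + k)%N => t tk.
have -> : t = (t0 + n + (t - (t0 + n + k)) + k)%N by lia.
apply: Qk; elim: (t - _)%N => [|u ih]; first by rewrite addn0.
by rewrite addnS; exact: Qa.
Qed.

Lemma periodic_modn (V : Type) (f : nat -> V) m :
  (forall t, f (t + m)%N = f t) -> forall t u, t = u %[mod m] -> f t = f u.
Proof.
move=> fm t u tu; have fM n v : f (v + n * m)%N = f v.
  by elim: n => [|n ih]; rewrite ?addn0// mulSn addnCA addnC fm.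
by rewrite (divn_eq t m) (divn_eq u m) addnC fM addnC tu [RHS]fM.
Qed.

(** * Real-valued probabilities *)

Section real_probability.
Context {d : measure_display} {T : measurableType d} {R : realType}.
Variable P : probability T R.
Implicit Types A B : set T.

Definition pr A : R := fine (P A).

Lemma prE A : measurable A -> P A = (pr A)%:E.
Proof. by move=> mA; rewrite /pr fineK// fin_num_measure. Qed.

Lemma pr_ge0 A : 0 <= pr A.
Proof. by rewrite /pr fine_ge0. Qed.

Lemma pr_setT : pr setT = 1.
Proof. by rewrite /pr probability_setT. Qed.

Lemma pr_set0 : pr set0 = 0.
Proof. by rewrite /pr measure0. Qed.

Lemma pr_le A B : measurable A -> measurable B -> A `<=` B -> pr A <= pr B.
Proof.
by move=> mA mB AB; rewrite -lee_fin -!prE// le_measure// inE.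
Qed.

Lemma pr_split A B : measurable A -> measurable B ->
  pr A = pr (A `&` B) + pr (A `\` B).
Proof.
move=> mA mB; apply: EFin_inj; rewrite EFinD -!prE//.
- by rewrite (measureDI P mA mB) addeC.
- exact: measurableD.
- exact: measurableI.
Qed.

Lemma pr_setC A : measurable A -> pr (~` A) = 1 - pr A.
Proof.
move=> mA; have := pr_split measurableT mA.
by rewrite pr_setT setTI setTD => ->; rewrite addrC addKr.
Qed.

Lemma pr_disj A B : measurable A -> measurable B -> A `&` B = set0 ->
  pr (A `|` B) = pr A + pr B.
Proof.
move=> mA mB AB; rewrite (pr_split _ mA) ?setUK//; last exact: measurableU.
congr (_ + pr _); apply/seteqP; split => [w [[]]//|w Bw]; split; [by right|].
by move=> Aw; have : (A `&` B) w by []; rewrite AB.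
Qed.

Lemma pr_null_le A B : measurable A -> measurable B ->
  pr (A `\` B) = 0 -> pr A <= pr B.
Proof.
move=> mA mB AB; rewrite (pr_split mA mB) AB addr0; apply: pr_le => //.
exact: measurableI.
Qed.

Lemma pr_setU_le A B : measurable A -> measurable B ->
  pr (A `|` B) <= pr A + pr B.
Proof.
move=> mA mB; rewrite (pr_split (measurableU _ _ mA mB) mA) setUK lerD2l.
by apply: pr_le => //; [apply/measurableD/mA/measurableU|move=> w [[]]].
Qed.

Lemma pr_gt0_nonempty A : 0 < pr A -> exists w, A w.
Proof.
move=> A0; apply: contrapT => /forallNP nA; suff A00 : A = set0.
  by move: A0; rewrite A00 pr_set0 ltxx.
by apply/seteqP; split => // w /nA.
Qed.

Lemma pr_cvg_up (F : nat -> set T) : (forall n, measurable (F n)) ->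
  (forall n, F n `<=` F n.+1) -> pr (F n) @[n --> \oo] --> pr (\bigcup_n F n).
Proof.
move=> mF sF; apply: fine_cvg; rewrite -prE; last exact: bigcupT_measurable.
apply: nondecreasing_cvg_mu => //; first exact: bigcupT_measurable.
by apply/nondecreasing_seqP => n; apply/subsetPset; exact: sF.
Qed.

Lemma pr_cvg_down (F : nat -> set T) : (forall n, measurable (F n)) ->
  (forall n, F n.+1 `<=` F n) -> pr (F n) @[n --> \oo] --> pr (\bigcap_n F n).
Proof.
move=> mF sF; apply: fine_cvg; rewrite -prE; last exact: bigcapT_measurable.
apply: nonincreasing_cvg_mu => //.
- by rewrite ltey_eq fin_num_measure.
- exact: bigcapT_measurable.
- by apply/nonincreasing_seqP => n; apply/subsetPset; exact: sF.
Qed.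

Lemma pr_bigcup0 (F : nat -> set T) : (forall n, measurable (F n)) ->
  (forall n, pr (F n) = 0) -> pr (\bigcup_n F n) = 0.
Proof.
move=> mF F0; apply: EFin_inj; rewrite -prE; last exact: bigcupT_measurable.
apply/eqP; rewrite eq_le measure_ge0 andbT.
apply: (le_trans (measure_sigma_subadditive P mF (bigcupT_measurable F mF) _)).
  by [].
rewrite eseries0// => n _ _. by have := prE (mF n); rewrite F0.
Qed.

Lemma pr_bigcup_scale (F : nat -> set T) A (c : R) : 0 <= c ->
    (forall n, measurable (F n)) -> measurable A -> trivIset setT F ->
    (forall n, c * pr (F n) <= pr (A `&` F n)) ->
  c * pr (\bigcup_n F n) <= pr (A `&` \bigcup_n F n).
Proof.
move=> c0 mF mA tF cF.
have mU := bigcupT_measurable F mF.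
rewrite -lee_fin EFinM -!prE//; last exact: measurableI.
rewrite setI_bigcupr !measure_bigcup//; last 2 first.
- by move=> i _; exact: measurableI.
- exact: trivIset_setIl.
rewrite -nneseriesZl//; apply: lee_nneseries.
- by move=> n _ _; rewrite mule_ge0.
- move=> n _; move: (cF n); rewrite -lee_fin EFinM -!prE//.
  exact: measurableI.
Qed.

End real_probability.

(** * Prefix events and Levy's 0-1 law *)

Section prefixes.
Context {d : measure_display} {T : measurableType d} {R : realType}.
Context {P : probability T R}.
Variable X : nat -> {RV P >-> nat}.
Local Notation pr := (pr P).
Implicit Types (A B : set T) (s : seq nat) (Q : set (seq nat)) (w : T).

(** A prefix of length [n] records the times 0 to [n - 1]; a history up to time [n] is therefore a
    sequence of size [n.+1]. *)
Definition prefix n w : seq nat := mkseq (fun k => X k w) n.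

Definition cyl s : set T := [set w | prefix (size s) w = s].

Definition eventually_pre Q : set T :=
  [set w | exists N, forall n, (N <= n)%N -> Q (prefix n w)].

Definition hit Q : set T := [set w | exists n, Q (prefix n w)].

Lemma size_prefix n w : size (prefix n w) = n.
Proof. exact: size_mkseq. Qed.

Lemma prefixS n w : prefix n.+1 w = rcons (prefix n w) (X n w).
Proof. by rewrite /prefix /mkseq -addn1 iotaD map_cat cats1. Qed.

Lemma last_prefix x n w : last x (prefix n.+1 w) = X n w.
Proof. by rewrite prefixS last_rcons. Qed.

Lemma take_prefix k n w : (k <= n)%N -> take k (prefix n w) = prefix k w.
Proof.
by move=> kn; rewrite /prefix /mkseq -map_take take_iota; move/minn_idPl: kn => ->.
Qed.

Lemma cyl_prefix n w : cyl (prefix n w) w.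
Proof. by rewrite /cyl /= size_prefix. Qed.

Lemma cyl_rcons s j : cyl (rcons s j) = cyl s `&` X (size s) @^-1` [set j].
Proof.
rewrite /cyl size_rcons; apply/seteqP; split => w /=; rewrite prefixS.
  by move=> /rcons_inj[-> ->].
by move=> [-> ->].
Qed.

Lemma mem_cyl s w : cyl s w <-> forall k, (k < size s)%N -> X k w = nth 0%N s k.
Proof.
rewrite /cyl /=; split=> [<- k|Xs].
  by rewrite size_prefix => ks; rewrite nth_mkseq.
apply: (@eq_from_nth _ 0%N); rewrite size_prefix// => k ks.
by rewrite nth_mkseq// Xs.
Qed.

Lemma measurable_cyl s : measurable (cyl s).
Proof.
elim/last_ind: s => [|s j ihs].
  by rewrite (_ : cyl [::] = setT)//; apply/seteqP; split.
by rewrite cyl_rcons; apply: measurableI => //; exact: measurable_funPTI.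
Qed.
Hint Resolve measurable_cyl : core.

(** There are countably many finite sequences of states; enumerating them by [pickle_inv] turns an
    event about prefixes into a countable union of cylinders. *)
Let piece Q (k : nat) : set T :=
  if pickle_inv k is Some s then if `[< Q s >] then cyl s else set0 else set0.

Let measurable_piece Q k : measurable (piece Q k).
Proof. by rewrite /piece; case: pickle_inv => // s; case: asboolP. Qed.

Let bigcup_piece Q : \bigcup_k piece Q k = [set w | exists2 s, Q s & cyl s w].
Proof.
apply/seteqP; split => [w [k _]|w [s Qs ws]].
  by rewrite /piece; case: pickle_inv => // s; case: asboolP => // Qs ws; exists s.
by exists (pickle s) => //; rewrite /piece pickleK_inv; case: asboolP.
Qed.

Lemma measurable_hit Q : measurable (hit Q).
Proof.
rewrite (_ : hit Q = \bigcup_k piece Q k); first exact: bigcupT_measurable.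
rewrite bigcup_piece; apply/seteqP; split => [w [n Qn]|w [s Qs ws]].
  by exists (prefix n w) => //; exact: cyl_prefix.
by exists (size s); rewrite ws.
Qed.

Lemma measurable_prefix n Q : measurable [set w | Q (prefix n w)].
Proof.
rewrite (_ : mkset _ = hit [set s | size s = n /\ Q s]); first exact: measurable_hit.
apply/seteqP; split => [w Qw|w [k [/=]]]; first by exists n; rewrite /= size_prefix.
by rewrite size_prefix => ->.
Qed.

Lemma measurable_eventually Q : measurable (eventually_pre Q).
Proof.
rewrite (_ : eventually_pre Q =
  \bigcup_N \bigcap_(n in [set n | (N <= n)%N]) [set w | Q (prefix n w)]).
  apply: bigcupT_measurable => N; apply: bigcap_measurable => [|n _].
    by exists N => /=.
  exact: measurable_prefix.
by apply/seteqP; split => [w [N wN]|w [N _ wN]]; exists N.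
Qed.

(* A hitting event is the disjoint union of the cylinders over the minimal
   prefixes that trigger it. *)
Lemma pr_hit_scale Q A (c : R) : 0 <= c -> measurable A ->
    (forall s, Q s -> c * pr (cyl s) <= pr (A `&` cyl s)) ->
  c * pr (hit Q) <= pr (A `&` hit Q).
Proof.
move=> c0 mA cQ.
pose M s := Q s /\ forall k, (k < size s)%N -> ~ Q (take k s).
have -> : hit Q = \bigcup_k piece M k.
  rewrite bigcup_piece; apply/seteqP; split => [w [n Qn]|w [s [Qs _] ws]]; last first.
    by exists (size s); rewrite ws.
  have exQ : exists n, `[< Q (prefix n w) >] by exists n; apply/asboolP.
  case: (ex_minnP exQ) => k /asboolP Qk kmin.
  exists (prefix k w); last exact: cyl_prefix.
  split => // l; rewrite size_prefix => lk; rewrite take_prefix 1?ltnW// => Ql.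
  by have := kmin l; rewrite leqNgt lk => /(_ _)/negP; apply => //; apply/asboolP.
apply: pr_bigcup_scale => //.
  move=> k l _ _ [w []]; rewrite /piece.
  have := @pickle_invK (seq nat) k; case: pickle_inv => //= s <-.
  have := @pickle_invK (seq nat) l; case: pickle_inv => //= t <-.
  case: asboolP => // -[Qs mins] ws; case: asboolP => // -[Qt mint] wt.
  congr pickle; case: (ltngtP (size s) (size t)) => [st|ts|st].
  - by case: (mint _ st); rewrite -wt take_prefix 1?ltnW// ws.
  - by case: (mins _ ts); rewrite -ws take_prefix 1?ltnW// wt.
  - by rewrite -ws -wt st.
move=> k; rewrite /piece; case: pickle_inv => [s|]; last by rewrite setI0 pr_set0 mulr0.
by case: asboolP => [[Qs _]|_]; [exact: cQ|rewrite setI0 pr_set0 mulr0].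
Qed.


(** Stands in for measurability with respect to the process: [A] differs arbitrarily little from an
    event of finitely many steps, each half of the symmetric difference being bounded by [e]. *)
Definition approximable A := measurable A /\ forall e : R, 0 < e ->
  exists n Q, pr (A `\` [set w | Q (prefix n w)]) <= e /\
              pr ([set w | Q (prefix n w)] `\` A) <= e.

Lemma approximableC A : approximable A -> approximable (~` A).
Proof.
move=> [mA apA]; split; first exact: measurableC.
move=> e /apA[n [Q [A1 A2]]]; exists n, (~` Q); split.
  rewrite (_ : _ `\` _ = [set w | Q (prefix n w)] `\` A)//.
  apply/seteqP; split => w /= [wA wQ]; split => //; exact: contrapT.
rewrite (_ : _ `\` _ = A `\` [set w | Q (prefix n w)])//.
by apply/seteqP; split => w /= [wA wQ]; split => //; apply: contrapT.
Qed.

(** [Q] from time [N] on increases to the event as [N] grows, and is itself the decreasing limit of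
    [Q] between [N] and [N + L]. Each of the two limits costs [e / 2]. *)
Lemma approximable_eventually Q : approximable (eventually_pre Q).
Proof.
split=> [|e e0]; first exact: measurable_eventually.
have e20 : 0 < e / 2 by rewrite divr_gt0.
pose QF N L : set (seq nat) :=
  [set s | forall n, (N <= n <= N + L)%N -> Q (take n s)].
pose F N L := [set w | QF N L (prefix (N + L) w)].
pose G N := \bigcap_L F N L.
have FE N L : F N L = [set w | forall n, (N <= n <= N + L)%N -> Q (prefix n w)].
  by apply/seteqP; split => w /= wF n nNL; have := wF n nNL;
    rewrite take_prefix//; case/andP: nNL.
have mF N L : measurable (F N L) by exact: measurable_prefix.
have mG N : measurable (G N) by exact: bigcapT_measurable.
have GE N : G N = [set w | forall n, (N <= n)%N -> Q (prefix n w)].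
  apply/seteqP; split => w /= wG n; last by move=> _; rewrite FE => k /andP[/wG].
  by move=> Nn; have := wG (n - N)%N; rewrite FE; apply => //; rewrite subnKC// Nn leqnn.
have UG : eventually_pre Q = \bigcup_N G N.
  apply/seteqP; split => [w [N wN]|w [N _]]; first by exists N => //; rewrite GE.
  by rewrite GE; exists N.
have cG : pr (G N) @[N --> \oo] --> pr (eventually_pre Q).
  rewrite UG; apply: pr_cvg_up => // N; rewrite !GE => w /= wN n Nn.
  by apply: wN; exact: ltnW.
have sub A B : measurable A -> measurable B -> B `<=` A ->
    pr (A `\` B) = pr A - pr B.
  by move=> mA mB BA; have := pr_split P mA mB; rewrite setIidr//; lra.
have mE := measurable_eventually Q.
have [N GN] : exists N, pr (eventually_pre Q `\` G N) <= e / 2.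
  have /cvgrPdist_le /(_ _ e20) [N _ /(_ N (leqnn _)) /=] := cG.
  move=> cN; exists N; rewrite sub//; last by rewrite UG; exact: bigcup_sup.
  by apply: le_trans (ler_norm _) _.
have cF : pr (F N L) @[L --> \oo] --> pr (G N).
  apply: pr_cvg_down => // L w; rewrite !FE => wF n /andP[Nn nL]; apply: wF.
  by rewrite Nn (leq_trans nL)// leq_add2l.
have [L FL] : exists L, pr (F N L `\` G N) <= e / 2.
  have /cvgrPdist_le /(_ _ e20) [L _ /(_ L (leqnn _)) /=] := cF.
  move=> cL; exists L; rewrite sub//; last by move=> w /(_ L I).
  by apply: le_trans (ler_norm _) _; rewrite distrC.
have ee : e / 2 <= e by lra.
exists (N + L)%N, (QF N L); rewrite -/(F N L); split.
  apply: le_trans (le_trans GN ee).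
  apply: pr_le; [exact: measurableD|exact: measurableD|].
  by apply: setDS => w /(_ L I).
apply: le_trans (le_trans FL ee).
apply: pr_le; [exact: measurableD|exact: measurableD|].
by apply: setDS; rewrite UG; exact: bigcup_sup.
Qed.

(* The maximal inequality behind Levy's 0-1 law: if A is close to an event B
   of the first n0 steps, then the prefixes at which A^c regains conditional
   probability e trigger a hitting event inside B of probability at most
   P(B \ A) / e. *)
Lemma levy A (e : R) : approximable A -> 0 < pr A -> 0 < e ->
  exists B n0, [/\ measurable B, B `<=` A, 0 < pr B &
    forall w n, B w -> (n0 <= n)%N ->
      (1 - e) * pr (cyl (prefix n w)) <= pr (A `&` cyl (prefix n w))].
Proof.
move=> [mA apA] A0 e0.
(* The bound [dl] is chosen so that [dl + dl / e] is half of [pr A]: removing both [A] minus [B] and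
   the bad event from [A] leaves positive probability. *)
have [] := apA (pr A * e / (2 * (1 + e))); first by rewrite divr_gt0 ?mulr_gt0 ?addr_gt0.
move=> n0 [Q []]; set B := [set w | Q (prefix n0 w)]; set dl := _ / _ => AB BA.
have mB : measurable B by exact: measurable_prefix.
pose bad s := [/\ (n0 <= size s)%N, Q (take n0 s) &
  e * pr (cyl s) <= pr (~` A `&` cyl s)].
have mbad := measurable_hit bad.
have badB : hit bad `<=` B.
  by move=> w [n []]; rewrite size_prefix => n0n; rewrite take_prefix.
have hitd : e * pr (hit bad) <= dl.
  apply: le_trans BA; apply: le_trans (pr_hit_scale (ltW e0) (measurableC mA) _) _.
    by move=> s [].
  apply: pr_le; [exact/measurableI/mbad/measurableC|exact: measurableD|].
  by move=> w [wA /badB].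
have mAB : measurable (A `&` B) by exact: measurableI.
exists ((A `&` B) `\` hit bad), n0; split.
- exact: measurableD.
- by move=> w [[]].
- have h1 := pr_split P mA mB; have h2 := pr_split P mAB mbad.
  have h3 : pr (A `&` B `&` hit bad) <= pr (hit bad).
    by apply: pr_le => //; exact: measurableI.
  have h4 : dl + dl / e = pr A / 2.
    by rewrite /dl; field; rewrite !gt_eqF// addr_gt0.
  have h5 : pr (hit bad) <= dl / e by rewrite ler_pdivlMr// mulrC.
  by move: A0 AB; lra.
- move=> w n [[wA wB] wbad] n0n.
  set C := cyl _.
  have : ~ (e * pr C <= pr (~` A `&` C)).
    move=> wC; apply: wbad; exists n; split; rewrite ?size_prefix//.
    by rewrite take_prefix.
  move=> /negP; rewrite -ltNge => h1.
  have := pr_split P (measurable_cyl (prefix n w)) mA; rewrite -/C setIC => h2.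
  move: h1; rewrite setIC -setDE; lra.
Qed.

(** On these paths one may divide by the probability of any prefix, and no transition of probability
    zero occurs. *)
Definition charged : set T := [set w | forall n, 0 < pr (cyl (prefix n w))].

Lemma chargedE : charged = ~` hit [set s | pr (cyl s) = 0].
Proof.
apply/seteqP; split => w /= wc.
  by move=> [n]; have := wc n => /[swap] /= ->; rewrite ltxx.
move=> n; rewrite lt_neqAle pr_ge0 andbT eq_sym; apply/eqP => w0; apply: wc.
by exists n.
Qed.

Lemma measurable_charged : measurable charged.
Proof. by rewrite chargedE; apply/measurableC/measurable_hit. Qed.

(** Scaling with the empty event and factor 1: null cylinders satisfy the required inequality
    trivially, so hitting one has probability 0. *)
Lemma pr_charged : pr charged = 1.
Proof.
rewrite chargedE pr_setC; last exact: measurable_hit.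
apply/eqP; rewrite subr_eq addrC eq_sym -subr_eq0 addrK eq_le pr_ge0 andbT -[leLHS]mul1r.
apply: le_trans (pr_hit_scale (A := set0) _ _ _) _ => //.
  by move=> s /= ->; rewrite mulr0 pr_ge0.
by rewrite set0I pr_set0.
Qed.

(** Were [A] of positive probability, some charged path would have late prefixes with conditional
    probability at least [1 - c / 2], against the bound [1 - c]. *)
Lemma levy_null A (c : R) n1 : approximable A -> 0 < c ->
  (forall s, (n1 <= size s)%N -> pr (A `&` cyl s) <= (1 - c) * pr (cyl s)) ->
  pr A = 0.
Proof.
move=> apA c0 Ac; apply/eqP; rewrite eq_le pr_ge0 andbT leNgt; apply/negP => A0.
have [|B [n [mB BA B0 Bw]]] := levy apA A0 (e := c / 2); first exact: divr_gt0.
have [w [wB wc]] : exists w, (B `&` charged) w.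
  apply: (@pr_gt0_nonempty _ _ _ P); have := pr_split P mB measurable_charged.
  suff -> : pr (B `\` charged) = 0 by rewrite addr0 => <-.
  apply/eqP; rewrite eq_le pr_ge0 andbT.
  rewrite (_ : 0 = pr (~` charged)).
    apply: pr_le; [|exact/measurableC/measurable_charged|by move=> w []].
    exact: (measurableD mB measurable_charged).
  by rewrite pr_setC ?pr_charged ?subrr//; exact: measurable_charged.
have := le_trans (Bw _ (n + n1)%N wB (leq_addr _ _)) (Ac _ _).
rewrite size_prefix leq_addl => /(_ isT).
have := wc (n + n1)%N => w0; rewrite ler_pM2r//; lra.
Qed.

End prefixes.

(** * Blackwell decompositions into given classes *)

Section blackwell.
Context {d : measure_display} {T : measurableType d} {R : realType}.
Context {P : probability T R}.
Variable Y : nat -> {RV P >-> nat}.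
Local Notation pr := (pr P).
Implicit Types (D E : set nat) (w : T).

Lemma measurable_U_ev D : measurable (U_ev Y D).
Proof.
rewrite (_ : U_ev Y D =
    \bigcap_N \bigcup_(n in [set n | (N <= n)%N]) Y n @^-1` D).
  apply: bigcapT_measurable => N; apply: bigcup_measurable => n _.
  exact: measurable_funPTI.
by apply/seteqP; split => [w wU N _|w wU N];
  [have [n] := wU N|have [n] := wU N I]; exists n.
Qed.

Lemma measurable_L_ev D : measurable (L_ev Y D).
Proof.
rewrite (_ : L_ev Y D =
    \bigcup_N \bigcap_(n in [set n | (N <= n)%N]) Y n @^-1` D).
  apply: bigcupT_measurable => N; apply: bigcap_measurable => [|n _].
    by exists N => /=.
  exact: measurable_funPTI.
by apply/seteqP; split => [w [N wN]|w [N _ wN]]; exists N.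
Qed.

Hint Resolve measurable_U_ev measurable_L_ev : core.

Let measurable_UL D : measurable (U_ev Y D `\` L_ev Y D).
Proof. exact: measurableD. Qed.

Lemma L_ev_sub_U_ev D : L_ev Y D `<=` U_ev Y D.
Proof.
move=> w [N wN] M; exists (maxn N M); first exact: leq_maxr.
by apply: wN; exact: leq_maxl.
Qed.

Lemma sub_L_ev D E : D `<=` E -> L_ev Y D `<=` L_ev Y E.
Proof. by move=> DE w [N wN]; exists N => n /wN /DE. Qed.

Lemma sub_U_ev D E : D `<=` E -> U_ev Y D `<=` U_ev Y E.
Proof. by move=> DE w wU N; have [n Nn /DE] := wU N; exists n. Qed.

Lemma L_evI D E : L_ev Y D `&` L_ev Y E = L_ev Y (D `&` E).
Proof.
apply/seteqP; split => [w [[N wN] [M wM]]|w wDE].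
  by exists (maxn N M) => n; rewrite geq_max => /andP[/wN ? /wM].
by split; apply: sub_L_ev wDE => i [].
Qed.

Lemma U_ev_L_evI D E w : U_ev Y D w -> L_ev Y E w -> U_ev Y (D `&` E) w.
Proof.
move=> wD [N wN] M; have [n] := wD (maxn N M); rewrite geq_max => /andP[Nn Mn] Dn.
by exists n => //; split => //; exact: wN.
Qed.

Lemma L_ev_set0 w : ~ L_ev Y set0 w.
Proof. by move=> [N /(_ N (leqnn N))]. Qed.

Lemma U_ev_set0 w : ~ U_ev Y set0 w.
Proof. by move=> /(_ 0%N)[n]. Qed.

Lemma regularE D : regular Y D <-> pr (U_ev Y D `\` L_ev Y D) = 0.
Proof. by rewrite /regular prE//; split => [[]|->]. Qed.

Lemma transientE D : transient Y D <-> pr (U_ev Y D) = 0.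
Proof. by rewrite /transient prE//; split => [[]|->]. Qed.

Lemma almost_closedP D :
  almost_closed Y D <-> regular Y D /\ 0 < pr (L_ev Y D).
Proof.
split=> -[rD D0]; split => //.
  rewrite lt_neqAle pr_ge0 andbT eq_sym; apply/eqP => L0; apply: D0; apply/transientE.
  apply/eqP; rewrite eq_le pr_ge0 andbT -L0; apply: pr_null_le => //.
  exact/regularE.
move=> /transientE U0.
have := pr_le P (measurable_L_ev D) (measurable_U_ev D) (@L_ev_sub_U_ev D).
by rewrite U0 leNgt D0.
Qed.

(** * Classes that determine every Blackwell decomposition *)

Section classes.
Variables (M : nat) (C : nat -> set nat) (G : set T).
Hypothesis mG : measurable G.
Hypothesis G1 : pr (~` G) = 0.
Hypothesis C_disj : forall j k, j <> k -> C j `&` C k = set0.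
Hypothesis G_cover : forall w, G w -> exists2 j, (j < M)%N & L_ev Y (C j) w.
Hypothesis C_gt0 : forall j, (j < M)%N -> 0 < pr (L_ev Y (C j)).
Hypothesis G_fin : forall w D, G w -> finite_set D -> ~ L_ev Y D w.
Hypothesis G_inf : forall w j D, G w -> (j < M)%N -> L_ev Y (C j) w ->
  D `<=` C j -> infinite_set D -> U_ev Y D w.

Let null_sub A B : measurable A -> measurable B -> A `&` G `<=` B ->
  pr B = 0 -> pr A = 0.
Proof.
move=> mA mB AB B0; apply/eqP; rewrite eq_le pr_ge0 andbT.
have mGc : measurable (~` G) by exact: measurableC.
apply: (@le_trans _ _ (pr (B `|` ~` G))); last first.
  by apply: le_trans (pr_setU_le P mB mGc) _; rewrite B0 G1 addr0.
apply: pr_le => //; first exact: measurableU.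
by move=> w Aw; have [Gw|nGw] := pselect (G w); [left; exact: AB|right].
Qed.

(** Ownership matches almost closed sets with the classes; the sets of a decomposition are counted
    through it. *)
Let owns D j := pr (L_ev Y (C j) `\` L_ev Y D) = 0.

Let mCD D j : measurable (L_ev Y (C j) `\` L_ev Y D).
Proof. exact: measurableD. Qed.

Let L_ev_disj D E w : D `&` E = set0 -> L_ev Y D w -> L_ev Y E w -> False.
Proof.
move=> DE wD wE; have : (L_ev Y D `&` L_ev Y E) w by [].
by rewrite L_evI DE => /L_ev_set0.
Qed.

(* A regular set met infinitely often within the class C j swallows it: finite
   sets are left for good, infinite subsets of C j are visited forever. *)
Let regular_owns D j : (j < M)%N -> regular Y D ->
  0 < pr (U_ev Y D `&` L_ev Y (C j)) -> owns D j.
Proof.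
move=> jM /regularE rD.
have [fDC|iDC] := pselect (finite_set (D `&` C j)); last first.
  move=> _; apply: (null_sub (mCD D j) (measurable_UL D)) => // w [[wC wD] Gw].
  split => //; apply: (@sub_U_ev (D `&` C j)); first by move=> i [].
  by apply: G_inf wC _ _ => // i [].
suff -> : pr (U_ev Y D `&` L_ev Y (C j)) = 0 by rewrite ltxx.
apply: (@null_sub _ (U_ev Y D `\` L_ev Y D)) => //; first exact: measurableI.
move=> w [[wU wC] Gw]; split => // wD; apply: (G_fin Gw fDC).
by rewrite -L_evI.
Qed.

(** Almost every path settles in some class, so the visits to [D] split over the classes. If [D]
    owned none, every part would be null and [D] transient. *)
Let almost_closed_owns D : almost_closed Y D -> exists2 j, (j < M)%N & owns D j.
Proof.
move=> [rD tD]; apply: contrapT => nD; apply: tD; apply/transientE.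
pose F j := if (j < M)%N then U_ev Y D `&` L_ev Y (C j) else set0.
have mF j : measurable (F j).
  by rewrite /F; case: ifP => // _; exact: measurableI.
apply: (null_sub _ (bigcupT_measurable F mF)) => //.
  move=> w [wD /G_cover[j jM wC]]; exists j => //.
  by rewrite /F jM.
apply: pr_bigcup0 => // j; rewrite /F; case: ifPn => [jM|_]; last exact: pr_set0.
apply/eqP; rewrite eq_le pr_ge0 andbT leNgt; apply/negP => h.
by apply: nD; exists j => //; exact: regular_owns.
Qed.

Let owns_meet D E j : (j < M)%N -> owns D j -> owns E j -> D `&` E = set0 -> False.
Proof.
move=> jM Dj Ej DE; have := C_gt0 jM; suff -> : pr (L_ev Y (C j)) = 0 by rewrite ltxx.
have mU : measurable ((L_ev Y (C j) `\` L_ev Y D) `|` (L_ev Y (C j) `\` L_ev Y E)).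
  exact: measurableU.
apply: (null_sub _ mU) => //.
  move=> w [wC Gw]; have [wD|wD] := pselect (L_ev Y D w); last by left.
  by right; split => // wE; exact: L_ev_disj wD wE.
apply/eqP; rewrite eq_le pr_ge0 andbT.
by apply: le_trans (pr_setU_le _ _ _) _ => //; rewrite Dj Ej addr0.
Qed.

Let almost_closed_sub D E j : (j < M)%N -> E `<=` C j -> almost_closed Y E -> owns E j.
Proof.
move=> jM EC /almost_closed_owns[k kM kE].
have [->//|/C_disj jk] := pselect (j = k).
have := C_gt0 kM; suff -> : pr (L_ev Y (C k)) = 0 by rewrite ltxx.
apply: (null_sub _ (mCD E k)) => // w [wC Gw]; split => // /(sub_L_ev EC) wCj.
exact: L_ev_disj jk wCj wC.
Qed.

(** Two disjoint almost closed subsets would both own class [j], which is impossible. The piece is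
    regular because a path that visits it infinitely often can only settle in [C j]. *)
Let atomic_piece D j : (j < M)%N -> regular Y D -> owns D j ->
  atomic Y (D `&` C j).
Proof.
move=> jM rD Dj; split; last first.
  move=> [D1 [D2 [D1E D2E D12 ac1 ac2]]]; apply: (owns_meet jM _ _ D12).
    by apply: almost_closed_sub ac1 => // i /D1E[].
  by apply: almost_closed_sub ac2 => // i /D2E[].
apply/almost_closedP; split.
  apply/regularE; apply: (null_sub (measurable_UL _) (measurable_UL D)).
    move=> w [[wU wL] Gw]; split; first by apply: sub_U_ev wU => i [].
    move=> wD; apply: wL; rewrite -L_evI; split => //.
    have [k kM wk] := G_cover Gw.
    have [->//|/C_disj jk] := pselect (j = k).
    have := U_ev_L_evI wU wk; rewrite -setIA jk setI0 => /U_ev_set0 [].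
  exact/regularE.
rewrite -L_evI; have := C_gt0 jM.
by rewrite (pr_split P (measurable_L_ev (C j)) (measurable_L_ev D)) Dj addr0 setIC.
Qed.

Let class_atomic j : (j < M)%N -> atomic Y (C j).
Proof.
have LT : L_ev Y setT = setT by apply/seteqP; split => // w _; exists 0%N.
move=> jM; rewrite -(setTI (C j)); apply: atomic_piece => //.
  by apply/regularE; rewrite LT setDT pr_set0.
by rewrite /owns LT setDT pr_set0.
Qed.

Let class_inj j k : (j < M)%N -> C j = C k -> j = k.
Proof.
move=> jM Cjk; apply: contrapT => /C_disj; rewrite -Cjk setIid => Cj0.
by have := C_gt0 jM; rewrite Cj0 => /pr_gt0_nonempty[w /L_ev_set0].
Qed.

Let total_classes : P (\bigcup_(j in `I_M) L_ev Y (C j)) = 1%E.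
Proof.
have mU : measurable (\bigcup_(j in `I_M) L_ev Y (C j)) by exact: bigcup_measurable.
rewrite prE//; congr EFin.
have := pr_setC P mU; suff -> : pr (~` (\bigcup_(j in `I_M) L_ev Y (C j))) = 0 by lra.
apply: (@null_sub _ set0); [exact: measurableC|by []| |exact: pr_set0].
by move=> w [wU /G_cover[j jM wC]]; apply: wU; exists j.
Qed.

Let classes_blackwell : blackwell_decomposition Y (C @` `I_M).
Proof.
have nna D : (C @` `I_M) D -> ~ nonatomic Y D.
  by move=> [j jM <-] [_]; apply; exact: class_atomic.
split.
- exact/finite_set_countable/finite_image/finite_II.
- move=> _ _ [j jM <-] [k kM <-] [i [Cj Ck]]; congr C; apply: contrapT => /C_disj jk.
  by have : (C j `&` C k) i by []; rewrite jk.
- by move=> D [j jM <-]; case: (class_atomic jM).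
- by move=> D E /nna.
- by move=> D /nna.
- rewrite esum_set_image.
  + rewrite -measure_bigcup ?total_classes//.
    move=> j k jM kM [w [wj wk]]; apply: contrapT => /C_disj jk.
    exact: L_ev_disj jk wj wk.
  + by [].
  + by move=> j k; rewrite !inE => jM kM; exact: class_inj.
Qed.

(** If no member owned class [j], none would share positive probability with [L_ev Y (C j)], and the
    total mass of the members would be at most [1 - pr (L_ev Y (C j))], less than 1. *)
Let blackwell_owner B j : blackwell_decomposition Y B -> (j < M)%N ->
  exists2 D, B D & owns D j.
Proof.
move=> [cB dB acB _ _ tB] jM; apply: contrapT => nB.
have : (\esum_(D in B) P (L_ev Y D) <= (1 - pr (L_ev Y (C j)))%:E)%E.
  rewrite /esum; apply: ub_ereal_sup => _ [F [finF FB] <-].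
  have tF : trivIset F (L_ev Y).
    move=> D E /FB BD /FB BE [w [wD wE]]; apply: (dB _ _ BD BE).
    by apply/set0P/negP => /eqP DE0; exact: L_ev_disj DE0 wD wE.
  rewrite -measure_fin_bigcup//.
  set U := \bigcup_(D in F) _.
  have mU : measurable U by exact: fin_bigcup_measurable.
  apply: (@le_trans _ _ (pr U)%:E); first by rewrite -(prE P mU).
  rewrite lee_fin -pr_setC//.
  apply: pr_null_le => //; first exact: measurableC.
  rewrite setDE setCK.
  have mUC : measurable (U `&` L_ev Y (C j)) by exact: measurableI.
  apply: EFin_inj; rewrite -prE// setI_bigcupl measure_fin_bigcup//; last 2 first.
  - exact: trivIset_setIr.
  - by move=> D _; exact: measurableI.
  apply: fsbig1 => D FD.
  have mDC : measurable (L_ev Y D `&` L_ev Y (C j)) by exact: measurableI.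
  have mUDC : measurable (U_ev Y D `&` L_ev Y (C j)) by exact: measurableI.
  transitivity (pr (L_ev Y D `&` L_ev Y (C j)))%:E; first exact: prE.
  congr EFin; apply/eqP; rewrite eq_le pr_ge0 andbT leNgt; apply/negP => DC0.
  apply: nB; exists D; first exact: FB.
  apply: regular_owns => //; first by case: (acB _ (FB _ FD)).
  apply: lt_le_trans DC0 _; apply: pr_le => //.
  by apply: setSI; exact: L_ev_sub_U_ev.
rewrite tB lee_fin; have := C_gt0 jM; lra.
Qed.

(** The classes show that a decomposition exists, so the chosen [B] is one. It is in bijection with
    them: a class has a single owner since members are disjoint, and a member owns a single class
    since it is atomic. *)
Lemma beta_classes : beta Y = (M%:R)%:E.
Proof.
rewrite /beta; set B := xget _ _.
have BB : blackwell_decomposition Y B.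
  exact: (@xgetPex _ set0 [set B | blackwell_decomposition Y B]
    (ex_intro _ _ classes_blackwell)).
clearbody B; case: (BB) => _ dB acB _ naB _.
have [f fP] : exists f : nat -> set nat, forall j, (j < M)%N -> B (f j) /\ owns (f j) j.
  have h j : exists D, (j < M)%N -> B D /\ owns D j.
    have [jM|jM] := boolP (j < M)%N; last by exists set0.
    by have [D BD Dj] := blackwell_owner BB jM; exists D.
  by exists (fun j => projT1 (cid (h j))) => j jM; case: (cid (h j)) => D hD; exact: hD.
have disjB D E : B D -> B E -> D <> E -> D `&` E = set0.
  move=> BD BE DE; apply: contrapT => /eqP/set0P DE0; apply: DE.
  exact: dB.
have unique_owner D E j : (j < M)%N -> B D -> B E -> owns D j -> owns E j -> D = E.
  move=> jM BD BE Dj Ej; apply: contrapT => /(disjB _ _ BD BE).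
  exact: (owns_meet jM Dj Ej).
have unique_class D j k : (j < M)%N -> (k < M)%N -> B D -> owns D j -> owns D k -> j = k.
  move=> jM kM BD Dj Dk; have acD := acB _ BD; have [rD _] := acD.
  have aj := atomic_piece jM rD Dj; have ak := atomic_piece kM rD Dk.
  (* A nonatomic member has no atomic subset, yet it would contain its piece in [C j]. *)
  have [aD|naD] := pselect (atomic Y D); last first.
    by have [+ _] := naB _ BD (conj acD naD); case; exists (D `&` C j) => // i [].
  apply: contrapT => /C_disj jk; case: aD => _; apply.
  exists (D `&` C j), (D `&` C k); split; [by move=> i []|by move=> i []| | |].
  - by rewrite setIACA jk setI0.
  - by case: aj.
  - by case: ak.
have BE : B = f @` `I_M.
  apply/seteqP; split => [D BD|_ [j jM <-]]; last by case: (fP j jM).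
  have [j jM Dj] := almost_closed_owns (acB _ BD); exists j => //.
  by have [Bf fj] := fP j jM; exact: unique_owner Bf BD fj Dj.
have cardB : (B #= `I_M)%card.
  rewrite BE; apply: inj_card_eq => j k; rewrite !inE => jM kM fjk.
  have [Bj fj] := fP j jM; have [_ fk] := fP k kM.
  by apply: (unique_class (f j)) => //; rewrite fjk.
rewrite /counting (card_fset_set cardB) ifT//.
by apply/asboolP; exists M.
Qed.

End classes.
End blackwell.

(** * The birth-death chain *)

Section birth_death_chain.
Context {d : measure_display} {T : measurableType d} {R : realType}.
Context {P : probability T R}.
Variables (X : nat -> {RV P >-> nat}) (p q r : nat -> R).
Hypothesis p_gt0 : forall i, 0 < p i.
Hypothesis q0 : q 0%N = 0.
Hypothesis q_gt0 : forall i, 0 < q i.+1.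
Hypothesis r_ge0 : forall i, 0 <= r i.
Hypothesis pqr1 : forall i, p i + q i + r i = 1.
Hypothesis X_bd : markov_chain (birth_death p q r) X.
Local Notation pr := (pr P).
Local Notation K := (birth_death p q r).
Local Notation cyl := (cyl X).
Local Notation prefix := (prefix X).
Implicit Types (A B : set T) (s : seq nat) (w : T) (f : nat -> R).

Hint Resolve measurable_cyl : core.

Lemma q_ge0 i : 0 <= q i.
Proof. by case: i => [|i]; rewrite ?q0// ltW. Qed.

Lemma p_le1 i : p i <= 1.
Proof. have := pqr1 i; have := q_ge0 i; have := r_ge0 i; lra. Qed.

Lemma birth_deathU i : K i i.+1 = p i.
Proof. by rewrite /birth_death eqxx. Qed.

Lemma birth_deathD i : K i.+1 i = q i.+1.
Proof. by rewrite /birth_death eqxx; case: eqP => //; lia. Qed.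

Lemma birth_deathE i : K i i = r i.
Proof. by rewrite /birth_death eqxx; case: eqP => //; lia. Qed.

(** The Markov property on cylinders; the first state is governed by the unconstrained initial law,
    hence the nonempty history. *)
Lemma pr_cyl_rcons s j : (0 < size s)%N ->
  pr (cyl (rcons s j)) = pr (cyl s) * K (last 0%N s) j.
Proof.
case/lastP: s => // s i _; rewrite last_rcons.
have e1 : nth 0%N (rcons (rcons s i) j) (size s) = i.
  by rewrite nth_rcons size_rcons ltnSn nth_rcons ltnn eqxx.
have e2 : nth 0%N (rcons (rcons s i) j) (size s).+1 = j.
  by rewrite nth_rcons size_rcons ltnn eqxx.
have := X_bd (size s) (nth 0%N (rcons (rcons s i) j)); rewrite e1 e2 => h.
apply: EFin_inj; rewrite EFinM -!prE//.
rewrite (_ : cyl _ = [set w | forall k : nat, (k <= (size s).+1)%N ->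
    X k w = nth 0%N (rcons (rcons s i) j) k]); last first.
  by apply/seteqP; split=> w; [move/mem_cyl|move=> wk; apply/mem_cyl];
    rewrite ?size_rcons.
rewrite h; congr (P _ * _)%E.
apply/seteqP; split=> w.
  move=> wk; apply/mem_cyl => k; rewrite size_rcons ltnS => ks.
  by rewrite wk// [LHS]nth_rcons size_rcons ltnS ks.
move/mem_cyl => wk k ks; rewrite wk ?size_rcons//.
by rewrite [RHS]nth_rcons size_rcons ltnS ks.
Qed.

Definition neighbours i := if i is j.+1 then [:: i.+1; i; j] else [:: i.+1; i].

(** The one-step transition operator, giving the expectation of [f] after one step from [i]. At
    [i = 0] the convention [0.-1 = 0] does no harm, as [q 0] vanishes. *)
Definition bdop f i : R := p i * f i.+1 + q i * f i.-1 + r i * f i.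

Lemma sum_neighbours f i :
  \sum_(j <- neighbours i) K i j * f j = bdop f i.
Proof.
case: i => [|i]; rewrite /neighbours /bdop !big_cons big_nil birth_deathU birth_deathE.
  by rewrite q0 mul0r !addr0.
by rewrite birth_deathD addr0 addrA addrAC.
Qed.

Lemma uniq_neighbours i : uniq (neighbours i).
Proof. by case: i => [|i]//=; rewrite !inE; lia. Qed.

Lemma measurable_state n (D : set nat) : measurable [set w | D (X n w)].
Proof. exact: (measurable_funPTI (X n)). Qed.

Lemma pr_cyl_next A s (l : seq nat) : measurable A -> uniq l ->
  pr (A `&` cyl s `&` [set w | X (size s) w \in l]) =
    \sum_(j <- l) pr (A `&` cyl (rcons s j)).
Proof.
move=> mA; elim: l => [_|j l ih /= /andP[jl ul]].
  by rewrite big_nil (_ : _ `&` _ = set0) ?pr_set0//; apply/seteqP; split => // w [].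
rewrite big_cons -ih// -pr_disj//.
- congr pr; apply/seteqP; split => w; rewrite cyl_rcons /=.
    move=> [[wA ws]]; rewrite inE => /orP[/eqP wj|wl]; first by left.
    by right.
  by move=> [[wA [ws wj]]|[[wA ws] wl]]; split => //; rewrite inE ?wj ?eqxx ?wl ?orbT.
- exact: measurableI.
- apply: measurableI; first exact: measurableI.
  exact: (measurable_state (size s) [set j | j \in l]).
- apply/seteqP; split => // w []; rewrite cyl_rcons => -[_ [_ /= wj]] [_ /=].
  by rewrite wj (negPf jl).
Qed.

Lemma bdop_cst c i : bdop (fun=> c) i = c.
Proof. by rewrite /bdop -!mulrDl pqr1 mul1r. Qed.

Lemma pr_cyl_step A s : measurable A -> (0 < size s)%N ->
  pr (A `&` cyl s) = \sum_(j <- neighbours (last 0%N s)) pr (A `&` cyl (rcons s j)).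
Proof.
move=> mA s0; rewrite -pr_cyl_next ?uniq_neighbours//.
set N := neighbours _; set D := [set w | _].
have mD : measurable D by exact: (measurable_state (size s) [set j | j \in N]).
have mAs : measurable (A `&` cyl s) by exact: measurableI.
rewrite (pr_split P mAs mD) -[RHS]addr0; congr (_ + _).
apply/eqP; rewrite eq_le pr_ge0 andbT.
(* The transition probabilities to the neighbours sum to 1, so a step elsewhere is null. *)
have : pr (cyl s `\` D) = 0.
  have := pr_split P (measurable_cyl X s) mD.
  have := pr_cyl_next s measurableT (uniq_neighbours (last 0%N s)).
  rewrite setTI -/D => ->.
  under eq_bigr => j _ do rewrite setTI pr_cyl_rcons// -[K _ _]mulr1.
  by rewrite -mulr_sumr (sum_neighbours (fun=> 1)) bdop_cst mulr1; lra.
move=> <-; apply: pr_le.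
- exact: (measurableD mAs mD).
- exact: (measurableD (measurable_cyl X s) mD).
- by move=> w [[]].
Qed.

(** [f i] is the conditional probability of [A] given the history up to time [n], when that history
    ends in [i]; the product form covers null histories. *)
Definition conditional n A f :=
  forall s, size s = n.+1 -> pr (A `&` cyl s) = pr (cyl s) * f (last 0%N s).

Lemma conditional_step n A f : measurable A ->
  conditional n.+1 A f -> conditional n A (bdop f).
Proof.
move=> mA cA s sn; rewrite pr_cyl_step ?sn//.
under eq_bigr => j _ do
  rewrite cA ?size_rcons ?sn// last_rcons pr_cyl_rcons ?sn// -mulrA.
by rewrite -mulr_sumr sum_neighbours.
Qed.

Lemma conditional_restrict n A f (D : set nat) : conditional n A f ->
  conditional n (A `&` X n @^-1` D) (fun i => `[< D i >]%:R * f i).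
Proof.
move=> cA s; case/lastP: s => // s i; rewrite size_rcons => -[sn].
rewrite last_rcons; case: asboolP => Di.
  rewrite mul1r -{3}(last_rcons 0%N s i) -cA ?size_rcons ?sn//; congr pr.
  rewrite cyl_rcons sn; apply/seteqP; split => [w [[]]//|w [wA [ws /= wi]]].
  by split => //; split => //=; rewrite wi.
rewrite mul0r mulr0 cyl_rcons sn (_ : _ `&` _ = set0) ?pr_set0//.
by apply/seteqP; split => // w [[_ /=] /[swap] -[_ /= ->]].
Qed.

Lemma charged_step w n : charged X w ->
  [\/ X n.+1 w = (X n w).+1, X n.+1 w = X n w | X n w = (X n.+1 w).+1].
Proof.
move=> /(_ n.+2); rewrite prefixS pr_cyl_rcons ?size_prefix// last_prefix.
rewrite /birth_death; case: eqP => [|_]; first by constructor 1.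
case: eqP => [|_]; first by constructor 3.
by case: eqP => [|_]; [constructor 2|rewrite mulr0 ltxx].
Qed.

(** * Upward runs and unboundedness of almost every path *)

Definition up_run s n := s ++ iota (last 0%N s).+1 n.

Lemma size_up_run s n : size (up_run s n) = (size s + n)%N.
Proof. by rewrite size_cat size_iota. Qed.

Lemma last_up_run s n : last 0%N (up_run s n) = (last 0%N s + n)%N.
Proof.
rewrite last_cat; case: n => [|n]; first by rewrite addn0.
by rewrite -[X in iota _ X]addn1 iotaD last_cat /= addSnnS.
Qed.

Lemma up_runS s n : up_run s n.+1 = rcons (up_run s n) (last 0%N s + n).+1.
Proof. by rewrite /up_run -[X in iota _ X]addn1 iotaD -cats1 catA addSn. Qed.

Lemma pr_up_run s n : (0 < size s)%N ->
  pr (cyl (up_run s n)) = pr (cyl s) * \prod_(last 0%N s <= k < last 0%N s + n) p k.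
Proof.
move=> s0; elim: n => [|n ih].
  by rewrite /up_run cats0 addn0 big_geq// mulr1.
rewrite up_runS pr_cyl_rcons ?size_up_run ?addn_gt0 ?s0// ih last_up_run birth_deathU.
by rewrite addnS big_nat_recr ?leq_addr//= mulrA.
Qed.

Lemma cyl_up_run s n : cyl (up_run s n) `<=` cyl s.
Proof.
elim: n => [|n ih]; first by rewrite /up_run cats0.
by rewrite up_runS cyl_rcons => w [/ih].
Qed.

Lemma prod_p_gt0 i j : 0 < \prod_(i <= k < j) p k.
Proof. by apply: prodr_gt0. Qed.

Lemma prod_p_le1 i j : \prod_(i <= k < j) p k <= 1.
Proof. by apply: Num.Theory.prodr_ile1 => k _; rewrite ltW ?p_le1. Qed.

Lemma prod_p_cat i j k : (i <= j)%N -> (j <= k)%N ->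
  \prod_(i <= l < k) p l = \prod_(i <= l < j) p l * \prod_(j <= l < k) p l.
Proof. by move=> ij jk; rewrite -big_cat_nat. Qed.

Let bounded N n0 : set T := [set w | forall n, (n0 <= n)%N -> (X n w <= N)%N].

Let measurable_bounded N n0 : measurable (bounded N n0).
Proof.
rewrite (_ : bounded _ _ =
  \bigcap_(n in [set n | (n0 <= n)%N]) X n @^-1` [set i | (i <= N)%N])//.
apply: bigcap_measurable => [|n _]; first by exists n0 => /=.
exact: measurable_funPTI.
Qed.

(** Whatever the history, from a state at most [N] the chain climbs straight to [N.+1] with
    probability at least the product of [p 0] to [p N]. The conditional probability of staying
    bounded is thus kept away from 1, and [levy_null] applies. *)
Let pr_bounded N n0 : pr (bounded N n0) = 0.
Proof.
(* The prefix of length [k] ends at time [k - 1], hence the strict inequality [n0 < k]. *)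
pose Q : set (seq nat) := [set s | forall k, (n0 < k <= size s)%N ->
  (last 0%N (take k s) <= N)%N].
have QE n w : Q (prefix n w) <-> forall k, (n0 <= k < n)%N -> (X k w <= N)%N.
  rewrite /Q /= size_prefix; split=> wn k.
    move=> /andP[n0k kn]; have := wn k.+1; rewrite ltnS n0k kn => /(_ isT).
    by rewrite take_prefix// last_prefix.
  case: k => // k /andP[n0k kn]; rewrite take_prefix// last_prefix; apply: wn.
  by rewrite -ltnS n0k.
have -> : bounded N n0 = eventually_pre X Q.
  apply/seteqP; split => [w wN|w [M wM] n n0n].
    by exists 0%N => n _; apply/QE => k /andP[+ _]; exact: wN.
  have /QE := wM (maxn M n.+1) (leq_maxl _ _); apply.
  by rewrite n0n leq_maxr.
have apE := approximable_eventually X Q.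
apply: (levy_null (n1 := n0.+1) apE (prod_p_gt0 0 N.+1)) => s n0s.
have mE := measurable_eventually X Q.
have s0 : (0 < size s)%N by rewrite (leq_trans _ n0s).
suff : (\prod_(0 <= k < N.+1) p k) * pr (cyl s) <= pr (cyl s `\` eventually_pre X Q).
  have := pr_split P (measurable_cyl X s) mE; rewrite setIC; lra.
have [sN|Ns] := leqP (last 0%N s) N; last first.
  rewrite (_ : cyl s `\` _ = cyl s).
    by rewrite ler_piMl// ?pr_ge0// prod_p_le1.
  apply/seteqP; split => [w []//|w ws]; split => // -[M wM].
  have /QE/(_ (size s).-1) := wM (maxn M (size s)) (leq_maxl _ _).
  rewrite -(last_prefix X 0%N) prednK// ws [(_ <= N)%N]leqNgt Ns.
  move=> /(_ _)/negP; apply => //.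
  by rewrite -ltnS prednK// n0s leq_maxr.
pose L := (N.+1 - last 0%N s)%N.
have NL : (last 0%N s + L = N.+1)%N by rewrite /L; lia.
apply: (@le_trans _ _ (pr (cyl (up_run s L)))).
  rewrite pr_up_run// mulrC ler_wpM2l ?pr_ge0// NL.
  rewrite (@prod_p_cat 0 (last 0%N s)) ?(leq_trans sN)//.
  by rewrite ler_piMl ?prod_p_le1// ltW// prod_p_gt0.
apply: pr_le => //; first exact: (measurableD (measurable_cyl X s) mE).
move=> w wu; split; first exact: cyl_up_run wu.
move=> [M wM]; have [k sk] : exists k, (size s + L = k.+1)%N.
  by exists (size s + L).-1; rewrite prednK// addn_gt0 s0.
have /QE/(_ k) := wM (maxn M k.+1) (leq_maxl _ _).
rewrite -(last_prefix X 0%N) -sk -size_up_run wu last_up_run NL ltnn => /(_ _)/negP.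
by apply => //; rewrite size_up_run sk leq_maxr andbT; move: sk n0s sN; rewrite /L; lia.
Qed.

Definition good := charged X `&` ~` \bigcup_N \bigcup_n0 bounded N n0.

Lemma measurable_good : measurable good.
Proof.
apply: measurableI; first exact: measurable_charged.
by apply: measurableC; apply: bigcupT_measurable => N; exact: bigcupT_measurable.
Qed.

Lemma pr_setC_good : pr (~` good) = 0.
Proof.
have mB N : measurable (\bigcup_n0 bounded N n0) by exact: bigcupT_measurable.
have mBB : measurable (\bigcup_N \bigcup_n0 bounded N n0) by exact: bigcupT_measurable.
have mC : measurable (~` charged X) by exact/measurableC/measurable_charged.
apply/eqP; rewrite eq_le pr_ge0 andbT /good setCI setCK.
apply: le_trans (pr_setU_le _ mC mBB) _.
rewrite pr_setC ?pr_charged ?subrr ?add0r; last exact: measurable_charged.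
by rewrite pr_bigcup0// => N; rewrite pr_bigcup0.
Qed.

Lemma good_unbounded w N n0 : good w -> exists2 n, (n0 <= n)%N & (N < X n w)%N.
Proof.
move=> [_ wU]; apply: contrapT => wn; apply: wU; exists N => //; exists n0 => // n n0n.
by rewrite leqNgt; apply/negP => Nw; apply: wn; exists n.
Qed.

(** Take the first time from [n0] on at which the path is at or above [i]: a step gains at most 1,
    so the path is exactly at [i]. *)
Lemma good_visits w n0 i : good w -> (X n0 w <= i)%N ->
  exists2 n, (n0 <= n)%N & X n w = i.
Proof.
move=> gw wi; have [n1 n01 in1] := good_unbounded i n0 gw.
have exn : exists n, (n0 <= n)%N && (i <= X n w)%N by exists n1; rewrite n01 ltnW.
case: (ex_minnP exn) => n /andP[n0n iXn] nmin; exists n => //.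
case: (ltngtP n0 n) n0n => // [n0n _|nn0 _]; last first.
  by apply/eqP; rewrite eqn_leq iXn -nn0 wi.
case: n => // n in iXn nmin n0n *.
have : (X n w < i)%N.
  rewrite ltnNge; apply/negP => iw; have := nmin n; rewrite ltnn iw -ltnS n0n.
  by move=> /(_ isT).
by case: gw => /(charged_step n) [] + _; lia.
Qed.

(** * Harmonic functions of tail events *)

Lemma bdop_le f g i : (forall j, f j <= g j) -> bdop f i <= bdop g i.
Proof.
by move=> fg; rewrite /bdop !lerD// ler_wpM2l// ?q_ge0// ltW.
Qed.

Lemma bdop_cvg (F : nat -> nat -> R) f i :
  (forall j, F n j @[n --> \oo] --> f j) -> bdop (F n) i @[n --> \oo] --> bdop f i.
Proof.
move=> Ff; rewrite /bdop.
by apply: cvgD; [apply: cvgD|]; apply: cvgM => //; exact: cvg_cst.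
Qed.

Lemma conditional_setT n : conditional n setT (fun=> 1).
Proof. by move=> s _; rewrite setTI mulr1. Qed.

Lemma conditional_lim n (F : nat -> set T) (f : nat -> nat -> R) A g :
    (forall k, conditional n (F k) (f k)) ->
    (forall s, pr (F k `&` cyl s) @[k --> \oo] --> pr (A `&` cyl s)) ->
    (forall i, f k i @[k --> \oo] --> g i) ->
  conditional n A g.
Proof.
move=> cF FA fg s sn.
suff h : pr (F k `&` cyl s) @[k --> \oo] --> pr (cyl s) * g (last 0%N s).
  exact: (cvg_unique (@Rhausdorff R) (FA s) h).
under eq_fun do rewrite cF//.
by apply: cvgM; [exact: cvg_cst|exact: fg].
Qed.

Section harmonic.
Variables (C : set nat) (m : nat).
Hypothesis m_gt0 : (0 < m)%N.

Let allowed t : set nat := [set i | (m %| t)%N -> C i].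

Let stay_ev l t : set T :=
  [set w | forall k, (t <= k <= t + l)%N -> allowed k (X k w)].

(* Starting from i at time t, stay l t i is the probability that C is respected
   at the multiples of m up to time t + l, forever t i its limit in l, and
   late j t i the probability that C is respected from time t + j on. *)
Let stay := fix stay l t i : R :=
  `[< allowed t i >]%:R * (if l is l'.+1 then bdop (stay l' t.+1) i else 1).

Let stayE l t i : stay l.+1 t i = `[< allowed t i >]%:R * bdop (stay l t.+1) i.
Proof. by []. Qed.

Let stay_evS l t : stay_ev l.+1 t = stay_ev l t.+1 `&` X t @^-1` allowed t.
Proof.
apply/seteqP; split => [w wt|w [wt Xt] k /andP[]].
  split => [k /andP[tk kl]|]; last by apply: wt; rewrite leqnn leq_addr.
  by apply: wt; rewrite (ltnW tk) addnS -addSn.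
rewrite leq_eqVlt => /predU1P[<-//|tk] kl.
by apply: wt; rewrite tk addSn -addnS.
Qed.

Let measurable_stay_ev l t : measurable (stay_ev l t).
Proof.
elim: l t => [|l ih] t; last first.
  by rewrite stay_evS; apply: measurableI => //; exact: measurable_funPTI.
rewrite (_ : stay_ev 0 t = X t @^-1` allowed t); first exact: measurable_funPTI.
apply/seteqP; split => [w|w wt k]; rewrite ?addn0.
  by apply; rewrite addn0 leqnn.
by rewrite -eqn_leq => /eqP <-.
Qed.

Let stay_conditional l t : conditional t (stay_ev l t) (stay l t).
Proof.
elim: l t => [|l ih] t.
  rewrite (_ : stay_ev 0 t = setT `&` X t @^-1` allowed t).
    exact: (conditional_restrict _ (@conditional_setT t)).
  rewrite setTI; apply/seteqP; split => [w|w wt k]; rewrite ?addn0.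
    by apply; rewrite addn0 leqnn.
  by rewrite -eqn_leq => /eqP <-.
by rewrite stay_evS; apply/conditional_restrict/conditional_step.
Qed.

Let stay_ge0 l t i : 0 <= stay l t i.
Proof.
elim: l t i => [|l ih] t i /=; first by rewrite mulr1 ler0n.
by rewrite mulr_ge0 ?ler0n// -(bdop_cst 0 i); exact: bdop_le.
Qed.

Let stayS l t i : stay l.+1 t i <= stay l t i.
Proof.
elim: l t i => [|l ih] t i; rewrite !stayE.
  rewrite /= ler_wpM2l ?ler0n// -[leRHS](bdop_cst 1 i); apply: bdop_le => j.
  by rewrite mulr1; case: asboolP.
by rewrite ler_wpM2l ?ler0n//; exact: bdop_le.
Qed.

Let stay_le1 l t i : stay l t i <= 1.
Proof.
elim: l => [|l ih]; last exact: le_trans (stayS _ _ _) ih.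
by rewrite /= mulr1; case: asboolP.
Qed.

Let stayD l t i : stay l (t + m)%N i = stay l t i.
Proof.
have aD u : allowed (u + m)%N = allowed u.
  by apply/seteqP; split => j; rewrite /allowed /= dvdn_addl.
elim: l t i => [|l ih] t i /=; rewrite aD//.
by rewrite -addSn; congr (_ * _); rewrite /bdop !ih.
Qed.

Let forever t i : R := lim (stay l t i @[l --> \oo]).

Let stay_cvg t i : stay l t i @[l --> \oo] --> forever t i.
Proof.
apply: nonincreasing_is_cvgn; first by apply/nonincreasing_seqP => l; exact: stayS.
by exists 0 => _ [l _ <-]; exact: stay_ge0.
Qed.

Let forever_ge0 t i : 0 <= forever t i.
Proof.
by apply: limr_ge; [apply/cvg_ex; eexists; exact: stay_cvg|apply: nearW => l].
Qed.

Let forever_le1 t i : forever t i <= 1.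
Proof.
by apply: limr_le; [apply/cvg_ex; eexists; exact: stay_cvg|apply: nearW => l].
Qed.

Let foreverD t i : forever (t + m)%N i = forever t i.
Proof. by rewrite /forever; under eq_fun do rewrite stayD. Qed.

(** Dropping the constraint at time [t] can only raise the probability. This inequality makes [late]
    nondecreasing in [j]. *)
Let forever_le_step t i : forever t i <= bdop (forever t.+1) i.
Proof.
have h1 : stay l.+1 t i @[l --> \oo] --> forever t i.
  by have := @stay_cvg t i; rewrite -(cvg_shiftS (fun l => stay l t i)).
have h2 : bdop (stay l t.+1) i @[l --> \oo] --> bdop (forever t.+1) i.
  by apply: bdop_cvg => j; exact: stay_cvg.
apply: (ler_cvg_to h1 h2); apply: nearW => l /=.
rewrite -[leRHS]mul1r ler_wpM2r//; last by case: asboolP.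
by rewrite -(bdop_cst 0 i); exact: bdop_le.
Qed.

Let forever_ev t : set T := \bigcap_l stay_ev l t.

Let measurable_forever_ev t : measurable (forever_ev t).
Proof. exact: bigcapT_measurable. Qed.

Let forever_evE t : forever_ev t = [set w | forall k, (t <= k)%N -> allowed k (X k w)].
Proof.
apply/seteqP; split => w wt; last by move=> l _ k /andP[+ _]; exact: wt.
by move=> k tk; apply: (wt (k - t)%N I); rewrite tk subnKC/=.
Qed.

Let forever_conditional t : conditional t (forever_ev t) (forever t).
Proof.
apply: (conditional_lim (stay_conditional ^~ t)) => [s|i]; last exact: stay_cvg.
rewrite (_ : _ `&` _ = \bigcap_l (stay_ev l t `&` cyl s)); last first.
  apply/seteqP; split => [w [wt ws] l _|w wt]; first by split => //; exact: wt.
  by split => [l _|]; [case: (wt l I)|case: (wt 0%N I)].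
apply: pr_cvg_down => l; first exact: measurableI.
apply: setSI => w wl k /andP[tk kl]; apply: wl; rewrite tk (leq_trans kl)//.
by rewrite leq_add2l.
Qed.

Let late := fix late j t : nat -> R :=
  if j is j'.+1 then bdop (late j' t.+1) else forever t.

Let late_ge0 j t i : 0 <= late j t i.
Proof.
elim: j t i => [|j ih] t i //=.
by rewrite -(bdop_cst 0 i); exact: bdop_le.
Qed.

Let late_le1 j t i : late j t i <= 1.
Proof.
elim: j t i => [|j ih] t i //=.
by rewrite -[leRHS](bdop_cst 1 i); exact: bdop_le.
Qed.

Let lateS j t i : late j t i <= late j.+1 t i.
Proof.
by elim: j t i => [|j ih] t i; [exact: forever_le_step|exact: bdop_le].
Qed.

Let lateD j t i : late j (t + m)%N i = late j t i.
Proof.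
elim: j t i => [|j ih] t i /=; first exact: foreverD.
by rewrite -addSn /bdop !ih.
Qed.

Let late_conditional j t : conditional t (forever_ev (t + j)%N) (late j t).
Proof.
elim: j t => [|j ih] t /=; first by rewrite addn0; exact: forever_conditional.
by apply: conditional_step => //; rewrite addnS -addSn; exact: ih.
Qed.

Let harmonic t i : R := lim (late j t i @[j --> \oo]).

Let late_cvg t i : late j t i @[j --> \oo] --> harmonic t i.
Proof.
apply: nondecreasing_is_cvgn; first by apply/nondecreasing_seqP => j; exact: lateS.
by exists 1 => _ [l _ <-]; exact: late_le1.
Qed.

Let L_evE t : L_ev (mstep m X) C = \bigcup_j forever_ev (t + j)%N.
Proof.
apply/seteqP; split => [w [N wN]|w [j _]].
  exists (N * m)%N => //; rewrite forever_evE => k tk /dvdnP[n kn].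
  rewrite kn; apply: wN; rewrite -(leq_pmul2r m_gt0) -kn.
  by rewrite (leq_trans _ tk)// leq_addl.
rewrite forever_evE => wt; exists (t + j)%N => n tn; apply: wt; last exact: dvdn_mull.
by rewrite (leq_trans tn)// leq_pmulr.
Qed.

(** The event is the increasing union over [j] of respecting [C] from time [t + j] on, so the limit
    of [late] is its conditional probability. Conditioning alone would fix [h] only at pairs the
    chain can reach; the iterated operator defines it, harmonic and periodic, at all pairs. *)
Lemma harmonic_exists : exists h : nat -> nat -> R,
  [/\ forall t i, 0 <= h t i <= 1,
      forall t i, h t i = bdop (h t.+1) i,
      forall t i, h (t + m)%N i = h t i &
      forall t, conditional t (L_ev (mstep m X) C) (h t)].
Proof.
exists harmonic; split=> [t i|t i|t i|t].
- apply/andP; split; [apply: limr_ge|apply: limr_le];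
    by [apply/cvg_ex; eexists; exact: late_cvg|apply: nearW => l].
- have h1 : late j.+1 t i @[j --> \oo] --> harmonic t i.
    by have := @late_cvg t i; rewrite -(cvg_shiftS (fun l => late l t i)).
  have h2 : late j.+1 t i @[j --> \oo] --> bdop (harmonic t.+1) i.
    by apply: bdop_cvg => j; exact: late_cvg.
  exact: (cvg_unique (@Rhausdorff R) h1 h2).
- by rewrite /harmonic; under eq_fun do rewrite lateD.
- apply: (conditional_lim (late_conditional ^~ t)) => [s|i]; last exact: late_cvg.
  rewrite (L_evE t) setI_bigcupl; apply: pr_cvg_up => j; first exact: measurableI.
  apply: setSI; rewrite !forever_evE => w /= wt k tk; apply: wt.
  by rewrite (leq_trans _ tk)// leq_add2l.
Qed.

End harmonic.

(** * Climbing paths *)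

Lemma beta_mstep1 : beta (mstep 1 X) = 1%:E.
Proof.
have -> : mstep 1 X = X by apply/funext => n; rewrite /mstep muln1.
have LT : L_ev X setT = setT by apply/seteqP; split => // w _; exists 0%N.
(* The whole of S is the single class; the default [set0] keeps the family disjoint beyond index
   0. *)
apply: (@beta_classes _ _ _ _ X 1 (fun j => if j == 0%N then setT else set0) good).
- exact: measurable_good.
- exact: pr_setC_good.
- by move=> [|j] [|k] //= _; rewrite ?setI0 ?set0I.
- by move=> w _; exists 0%N => //=; rewrite LT.
- by move=> [|//] _ /=; rewrite LT pr_setT.
- move=> w D gw /finite_nat_bounded[N DN] [n0 wD].
  have [n n0n] := good_unbounded N n0 gw.
  by rewrite ltnNge DN//; exact: wD.
- move=> w [|//] D gw _ _ _ iD N; have [i Di Ni] := infinite_nat_unbounded (X N w) iD.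
  by have [n Nn ni] := good_visits gw Ni; exists n => //; rewrite ni.
Qed.

(** * Consequences of a state with a loop *)

Section loop.
Variable a : nat.
Hypothesis r_a_gt0 : 0 < r a.

(** The loop at [a] removes the parity obstruction: starting from a state charged by the initial
    law, [i] is reachable at every late time. *)
Lemma reachable_late i : exists t1, forall t, (t1 <= t)%N ->
  exists s, [/\ size s = t.+1, last 0%N s = i & 0 < pr (cyl s)].
Proof.
pose Q t j := exists s, [/\ size s = t.+1, last 0%N s = j & 0 < pr (cyl s)].
have QK t j k : 0 < K j k -> Q t j -> Q t.+1 k.
  move=> Kjk [s [st sj s0]]; exists (rcons s k).
  by rewrite size_rcons last_rcons st pr_cyl_rcons ?st// sj mulr_gt0.
have [w wc] : exists w, charged X w.
  by apply: (@pr_gt0_nonempty _ _ _ P); rewrite pr_charged ltr01.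
apply: (@reach Q a _ _ _ 0%N (X 0%N w)) => [t j|t j|t|].
- by apply: QK; rewrite birth_deathU.
- by apply: QK; rewrite birth_deathD.
- by apply: QK; rewrite birth_deathE.
- by exists (prefix 1 w); rewrite size_prefix last_prefix; split => //; exact: wc.
Qed.

(* Minimum principle for 1 - h. *)
Lemma harmonic_one (h : nat -> nat -> R) t0 i0 : (forall t i, h t i <= 1) ->
    (forall t i, h t i = bdop (h t.+1) i) -> h t0 i0 = 1 ->
  forall i, exists t1, forall t, (t1 <= t)%N -> h t i = 1.
Proof.
move=> h1 hK ht0.
have one (x y : R) : 0 < x -> y <= 1 -> 0 <= x * (y - 1) -> y = 1.
  move=> x0 y1; rewrite pmulr_rge0// subr_ge0 => ?.
  by apply/eqP; rewrite eq_le y1.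
have step t i : h t i = 1 -> 0 = p i * (h t.+1 i.+1 - 1) +
    q i * (h t.+1 i.-1 - 1) + r i * (h t.+1 i - 1).
  rewrite hK => e; transitivity (bdop (h t.+1) i - (p i + q i + r i)).
    by rewrite e pqr1 subrr.
  by rewrite /bdop; ring.
have le0 x t i : 0 <= x -> x * (h t i - 1) <= 0.
  by move=> x0; rewrite mulr_ge0_le0// subr_le0.
apply: (@reach (fun t i => h t i = 1) a _ _ _ t0 i0) => // t.
- move=> i /step e; apply: (one (p i) (h t.+1 i.+1)) => //.
  have := le0 _ t.+1 i.-1 (q_ge0 i); have := le0 _ t.+1 i (r_ge0 i); lra.
- move=> i /step e; apply: (one (q i.+1) (h t.+1 i)) => //.
  have := le0 _ t.+1 i.+2 (ltW (p_gt0 i.+1)); have := le0 _ t.+1 i.+1 (r_ge0 i.+1).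
  move: e => /=; lra.
- move=> /step e; apply: (one (r a) (h t.+1 a)) => //.
  have := le0 _ t.+1 a.+1 (ltW (p_gt0 a)); have := le0 _ t.+1 a.-1 (q_ge0 a); lra.
Qed.

(** * Chains that eventually climb at every step *)

Section climbing.
Variable c : R.
Hypothesis c_gt0 : 0 < c.
Hypothesis prod_p_ge : forall i j, c <= \prod_(i <= k < j) p k.

Let climb : set T := [set w | exists N, forall n, (N <= n)%N -> X n.+1 w = (X n w).+1].

Let climb_approximable : approximable X climb.
Proof.
pose Q : set (seq nat) := [set s | last 0%N s = (last 0%N (take (size s).-1 s)).+1].
have QE n w : Q (prefix n.+2 w) <-> X n.+1 w = (X n w).+1.
  have -> : Q (prefix n.+2 w) = (last 0%N (prefix n.+2 w) =
    (last 0%N (take (size (prefix n.+2 w)).-1 (prefix n.+2 w))).+1) by [].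
  by rewrite size_prefix take_prefix// !last_prefix.
have -> : climb = eventually_pre X Q; last exact: approximable_eventually.
apply/seteqP; split => w [N wN].
  by exists N.+2 => -[|[|n]]// Nn; apply/QE; exact: wN.
by exists N => n Nn; apply/QE; apply: wN; rewrite (leq_trans Nn)// -addn2 leq_addr.
Qed.

Let always_up s : set T := \bigcap_n cyl (up_run s n).

Let measurable_always_up s : measurable (always_up s).
Proof. by apply: bigcapT_measurable => n; exact: measurable_cyl. Qed.

Let always_up_state s w u : (0 < size s)%N -> always_up s w ->
  X ((size s).-1 + u)%N w = (last 0%N s + u)%N.
Proof.
move=> s0 /(_ u I) wu; rewrite -(last_prefix X 0%N) -addSn prednK//.
by rewrite -size_up_run wu last_up_run.
Qed.

Let pr_always_up s : (0 < size s)%N -> c * pr (cyl s) <= pr (always_up s).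
Proof.
move=> s0.
have cv : pr (cyl (up_run s n)) @[n --> \oo] --> pr (always_up s).
  by apply: pr_cvg_down => // n; rewrite up_runS cyl_rcons => w [].
have cc : c * pr (cyl s) @[n --> \oo] --> c * pr (cyl s) by exact: cvg_cst.
apply: (ler_cvg_to cc cv); apply: nearW => n.
by rewrite pr_up_run// mulrC ler_wpM2l ?pr_ge0.
Qed.

Let always_up_climb s : (0 < size s)%N -> always_up s `<=` climb.
Proof.
move=> s0 w wu; exists (size s).-1 => n sn.
rewrite -(subnKC sn) -addnS !(always_up_state _ s0 wu).
by rewrite addnS.
Qed.

(** After any nonempty history, only births follow with conditional probability at least [c]. The
    complement of [climb] thus has conditional probability at most [1 - c] everywhere, and Levy's
    law makes it null. *)
Let pr_setC_climb : pr (~` climb) = 0.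
Proof.
have mC : measurable climb by case: climb_approximable.
apply: (levy_null (n1 := 1) (approximableC climb_approximable) c_gt0) => s s0.
have h1 := pr_split P (measurable_cyl X s) mC.
have h2 : pr (always_up s) <= pr (cyl s `&` climb).
  apply: pr_le => //; first exact: measurableI.
  move=> w wu; split; last exact: always_up_climb wu.
  by have := wu 0%N I; rewrite /up_run cats0.
have := pr_always_up s0; rewrite setIC -setDE; lra.
Qed.

Let climbD w N k : (forall n, (N <= n)%N -> X n.+1 w = (X n w).+1) ->
  X (N + k)%N w = (X N w + k)%N.
Proof.
move=> wN; elim: k => [|k ih]; first by rewrite !addn0.
by rewrite addnS wN ?leq_addr// ih addnS.
Qed.

(** On a climbing path the [M]-step chain finally moves by exactly [M]: it settles in one residue
    class mod [M] and visits all of its large members. So the residue classes satisfy the hypotheses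
    of [beta_classes]. *)
Lemma beta_mstep_climb M : (0 < M)%N -> beta (mstep M X) = (M%:R)%:E.
Proof.
move=> M0.
have mC : measurable climb by case: climb_approximable.
have MX w N n k : (forall n, (N <= n)%N -> X n.+1 w = (X n w).+1) -> (N <= n)%N ->
    X ((n + k) * M)%N w = (X (n * M)%N w + k * M)%N.
  move=> wN Nn; rewrite mulnDl; apply: climbD => l nl; apply: wN.
  by rewrite (leq_trans Nn)// (leq_trans _ nl)// leq_pmulr.
apply: (@beta_classes _ _ _ _ _ M (fun j => [set i | (i %% M)%N = j]) climb) => //.
- by move=> j k jk; apply/seteqP; split => // i [/= -> ].
- move=> w [N wN]; exists (X (N * M)%N w %% M)%N; first exact: ltn_pmod.
  exists N => n Nn; rewrite /mstep /= -(subnKC Nn) (MX _ _ _ _ wN (leqnn N)).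
  by rewrite addnC modnMDl.
- move=> j jM; have [t1 tP] := reachable_late 0%N.
  (* [t] is congruent to [-j] mod [M]: a path at 0 at time [t] that climbs from then on is at
     [n * M - t] at time [n * M], hence in residue class [j]. *)
  pose t := (t1 * M + (M - j))%N.
  have [|s [st s0 sp]] := tP t.
    by rewrite /t (leq_trans _ (leq_addr _ _))// leq_pmulr.
  have s_gt0 : (0 < size s)%N by rewrite st.
  apply: (@lt_le_trans _ _ (pr (always_up s))).
    by apply: lt_le_trans (pr_always_up s_gt0); rewrite mulr_gt0.
  apply: pr_le => //; first exact: measurable_L_ev.
  move=> w wu; exists t => n tn.
  have tnM : (t <= n * M)%N by rewrite (leq_trans tn)// leq_pmulr.
  rewrite /mstep /= -(subnKC tnM).
  have := always_up_state (n * M - t)%N s_gt0 wu; rewrite st s0 add0n => ->.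
  rewrite -[RHS](modn_small jM); apply/eqP; rewrite -(eqn_modDr t) subnK//.
  have -> : (j + t = t1.+1 * M)%N by rewrite /t mulSn; lia.
  by rewrite !modnMl.
- move=> w D [N wN] /finite_nat_bounded[B DB] [n0 wD].
  have := wD (maxn N n0 + B.+1)%N; rewrite (leq_trans (leq_maxr N n0)) ?leq_addr//.
  move=> /(_ isT)/DB; rewrite /mstep (MX _ _ _ _ wN (leq_maxl _ _)).
  rewrite leqNgt => /negP; apply.
  by rewrite (@leq_trans (B.+1 * M)%N) ?leq_pmulr// leq_addl.
- move=> w j D [N wN] jM [n0 wC] DC iD n1.
  pose n := maxn N (maxn n0 n1).
  have [Nn n0n n1n] : [/\ (N <= n)%N, (n0 <= n)%N & (n1 <= n)%N].
    by rewrite /n; split; lia.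
  have [i Di ni] := infinite_nat_unbounded (X (n * M)%N w) iD.
  have /dvdnP[k kE] : (M %| i - X (n * M)%N w)%N.
    rewrite -eqn_mod_dvd//; apply/eqP.
    by rewrite (DC _ Di); symmetry; exact: (wC n n0n).
  exists (n + k)%N; first by rewrite (leq_trans n1n)// leq_addr.
  by rewrite /mstep (MX _ _ _ _ wN Nn) -kE subnKC.
Qed.

End climbing.

(** * The periodicity dichotomy *)

(** Factors are at most 1, so the product over [[i, j)] is at least the one over [[0, N + j)], whose
    first [N] factors form a positive constant. *)
Lemma prod_p_ge_of_tail N (c : R) : 0 < c ->
    (forall n, c <= \prod_(N <= k < N + n) p k) ->
  exists2 c' : R, 0 < c' & forall i j, c' <= \prod_(i <= k < j) p k.
Proof.
move=> c0 cN; exists ((\prod_(0 <= k < N) p k) * c).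
  by rewrite mulr_gt0// prod_p_gt0.
move=> i j; have [ji|/ltnW ij] := leqP j i.
  rewrite [leRHS]big_geq// mulr_ile1 ?prod_p_le1 ?(ltW (prod_p_gt0 _ _)) ?(ltW c0)//.
  by apply: le_trans (cN 0%N) _; rewrite addn0 big_geq.
apply: (@le_trans _ _ (\prod_(0 <= k < N + j) p k)).
  by rewrite (@prod_p_cat 0 N (N + j)) ?leq_addr// ler_pM2l ?prod_p_gt0.
rewrite (@prod_p_cat 0 i (N + j))//; last by rewrite (leq_trans ij)// leq_addl.
rewrite (@prod_p_cat i j (N + j))//; last exact: leq_addl.
rewrite mulrCA ler_piMr ?(ltW (prod_p_gt0 _ _))//.
by rewrite mulr_ile1 ?prod_p_le1 ?(ltW (prod_p_gt0 _ _)).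
Qed.

Section dichotomy.
Variables (h : nat -> nat -> R) (m : nat).
Hypothesis m_gt2 : (2 < m)%N.
Hypothesis h01 : forall t i, 0 <= h t i <= 1.
Hypothesis hK : forall t i, h t i = bdop (h t.+1) i.
Hypothesis hm : forall t i, h (t + m)%N i = h t i.
Hypothesis h_sep : forall e : R, 0 < e -> e < 1 / 2 -> exists I, forall i, (I <= i)%N ->
  exists t, 1 - e <= h t i /\ forall t', t' <> t %[mod m] -> h t' i <= e.

Let h_mod t t' i : t = t' %[mod m] -> h t i = h t' i.
Proof. by apply: (@periodic_modn _ (h ^~ i)) => s; exact: hm.
Qed.

Let mod_shift t k : (0 < k < m)%N -> (t + k)%N <> t %[mod m].
Proof.
move=> /andP[k0 km] /eqP; rewrite -[X in _ == (X %% _)%N]addn0 eqn_modDl.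
by rewrite mod0n modn_small// gtn_eqF.
Qed.

(* Either the residue at which h concentrates climbs from some state on, and the
   defect of h along the climb bounds the product of the p's; or it always
   descends, and then h increases along the descent up to 1. *)
Lemma prod_p_ge_exists : exists2 c : R, 0 < c & forall i j, c <= \prod_(i <= k < j) p k.
Proof.
have h_ge0 t i : 0 <= h t i by case/andP: (h01 t i).
have h_le1 t i : h t i <= 1 by case/andP: (h01 t i).
have mulle x y z : 0 <= x -> y <= z -> x * y <= x * z :> R.
  by move=> x0 yz; rewrite ler_wpM2l.
have [I sepI] := @h_sep (1 / 4) ltac:(lra) ltac:(lra).
pose conc t i := 3 / 4 <= h t i.
have conc_exists i : (I <= i)%N -> exists t, conc t i.
  by move=> /sepI[t [ht _]]; exists t; rewrite /conc; lra.
have not_conc t i : (I <= i)%N -> ~ conc t i -> h t i <= 1 / 4.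
  move=> /sepI[u [hu hn]] nt; apply: hn => tu; apply: nt.
  by rewrite /conc (h_mod _ tu); lra.
have conc_mod t u i : (I <= i)%N -> conc t i -> u <> t %[mod m] -> h u i <= 1 / 4.
  move=> Ii ct ut; apply: not_conc => // cu; apply: ut.
  have [v [hv hn]] := sepI _ Ii.
  have cv x : conc x i -> x = v %[mod m].
    move=> cx; apply: contrapT => /hn; move: cx; rewrite /conc; lra.
  by rewrite (cv _ ct) (cv _ cu).
have conc_stay t i : (I <= i)%N -> conc t i -> h t.+1 i <= 1 / 4.
  by move=> Ii ct; apply: conc_mod ct _ => //; rewrite -addn1; apply: mod_shift; lia.
have [[t [i [Ii ct cu]]]|down] := pselect (exists t i,
    [/\ (I <= i)%N, conc t i & conc t.+1 i.+1]).
  (* Here [m > 2] enters: a step up followed by a step down shifts the time by 2, which changes the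
     residue. *)
  have back n : (I <= n)%N -> forall u, conc u n -> h u.+2 n <= 1 / 4.
    move=> In u cun; apply: conc_mod cun _ => //.
    by rewrite -addn2; apply: mod_shift; lia.
  have climb n : conc (t + n)%N (i + n)%N /\ conc (t + n).+1 (i + n).+1.
    elim: n => [|n [ih1 ih2]]; first by rewrite !addn0.
    rewrite !addnS; split => //; apply: contrapT => /not_conc.
    rewrite (leq_trans Ii) ?leqW ?leq_addr// => /(_ isT) hu.
    have hq := back _ (leq_trans Ii (leq_addr n i)) _ ih1.
    have hr := conc_stay _ _ (leq_trans Ii (leqW (leq_addr n i))) ih2.
    move: ih2; rewrite /conc hK /bdop /=.
    have := mulle _ _ _ (ltW (p_gt0 (i + n).+1)) hu.
    have := mulle _ _ _ (q_ge0 (i + n).+1) hq.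
    have := mulle _ _ _ (r_ge0 (i + n).+1) hr.
    have := pqr1 (i + n).+1; lra.
  (* In the harmonic equation the terms for staying and for descending carry values at most 1/4, so
     subtracting 1/4 leaves only the upward term. *)
  have defect n : h (t + n).+1 (i + n).+1 - 1 / 4 <=
      p (i + n).+1 * (h (t + n).+2 (i + n).+2 - 1 / 4).
    have [ih1 ih2] := climb n.
    have hq := back _ (leq_trans Ii (leq_addr n i)) _ ih1.
    have hr := conc_stay _ _ (leq_trans Ii (leqW (leq_addr n i))) ih2.
    rewrite hK /bdop /=.
    have := mulle _ _ _ (q_ge0 (i + n).+1) hq.
    have := mulle _ _ _ (r_ge0 (i + n).+1) hr.
    have := pqr1 (i + n).+1; lra.
  apply: (@prod_p_ge_of_tail i.+1 (1 / 2)); first by lra.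
  have prodD n : 1 / 2 <= (\prod_(i.+1 <= k < i.+1 + n) p k) *
      (h (t + n).+1 (i + n).+1 - 1 / 4).
    elim: n => [|n ih].
      by rewrite addn0 big_geq// mul1r !addn0; move: cu; rewrite /conc; lra.
    have -> : \prod_(i.+1 <= k < i.+1 + n.+1) p k =
        \prod_(i.+1 <= k < i.+1 + n) p k * p (i + n).+1.
      by rewrite addnS big_nat_recr// leq_addr.
    apply: le_trans ih _; rewrite -mulrA ler_pM2l ?prod_p_gt0// !addnS.
    exact: defect.
  move=> n; apply: le_trans (prodD n) _; rewrite ler_piMr ?(ltW (prod_p_gt0 _ _))//.
  by have := h_le1 (t + n).+1 (i + n).+1; lra.
(* The average is at least 3/4 while the values upward and in place are at most 1/4, so the value
   downward is at least the average. *)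
have descend t i : (I <= i)%N -> conc t i.+1 -> h t i.+1 <= h t.+1 i.
  move=> Ii ct; have hr := conc_stay _ _ (leqW Ii) ct.
  have hp : h t.+1 i.+2 <= 1 / 4.
    apply: not_conc; first by lia.
    by move=> cu; apply: down; exists t, i.+1; split => //; exact: leqW.
  have hpp := mulle _ _ _ (ltW (p_gt0 i.+1)) hp.
  have hrr := mulle _ _ _ (r_ge0 i.+1) hr.
  have := pqr1 i.+1.
  have e := hK t i.+1; move: e; rewrite /bdop /= => e.
  have [hq|hq] := leP (h t.+1 i) (1 / 4).
    have := mulle _ _ _ (q_ge0 i.+1) hq; move: ct; rewrite /conc; lra.
  have : (p i.+1 + r i.+1) * (1 / 4) <= (p i.+1 + r i.+1) * h t.+1 i.
    by apply: mulle; [rewrite addr_ge0// ltW|exact: ltW].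
  nra.
have descend_n n : forall t, conc t (I + n)%N -> h t (I + n)%N <= h (t + n)%N I.
  elim: n => [|n ih] t ct; first by rewrite !addn0.
  rewrite addnS in ct *; have hd := descend t _ (leq_addr n I) ct.
  apply: (le_trans hd); rewrite -addSnnS; apply: ih.
  by move: ct; rewrite /conc => ct; exact: le_trans ct hd.
have [t0 ct0] := conc_exists _ (leqnn I).
(* For every small [e], a high state has [h] at least [1 - e] at some time. Descent carries this
   bound to [I], at a time which concentration forces into the residue of [t0]. *)
have ht0 : h t0 I = 1.
  apply/eqP; rewrite eq_le h_le1 /= leNgt; apply/negP => h1.
  pose e := Num.min (1 / 4) ((1 - h t0 I) / 2).
  have e0 : 0 < e by rewrite lt_min; apply/andP; split; lra.
  have [e1 e2] : e <= 1 / 4 /\ e <= (1 - h t0 I) / 2.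
    by split; rewrite /e ge_min lexx ?orbT.
  have [J sepJ] := @h_sep e e0 ltac:(lra).
  have [u [hu _]] := sepJ (I + J)%N (leq_addl _ _).
  have hn := descend_n J u ltac:(rewrite /conc; lra).
  have cI : conc (u + J)%N I by rewrite /conc; lra.
  have : h (u + J)%N I = h t0 I.
    apply: h_mod; apply: contrapT => /(conc_mod _ _ _ (leqnn I) ct0).
    move: cI; rewrite /conc; lra.
  lra.
(* Now [h] equals 1 at [I] at all late times, including one congruent to [t0.+1], where
   concentration at [t0] allows at most 1/4. *)
have [t1 one] := harmonic_one h_le1 hK ht0 I.
have := conc_stay _ _ (leqnn I) ct0.
rewrite -(@h_mod (t0.+1 + t1 * m)%N) ?one; first by lra.
  by rewrite (leq_trans _ (leq_addl _ _))// leq_pmulr//; lia.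
by rewrite addnC modnMDl.
Qed.

End dichotomy.

(** * From a Blackwell decomposition to concentrated harmonic functions *)

Lemma L_ev_mstep_approximable m C : (0 < m)%N -> approximable X (L_ev (mstep m X) C).
Proof.
move=> m0.
pose Q : set (seq nat) := [set s | (m %| (size s).-1)%N -> C (last 0%N s)].
have QE n w : Q (prefix n.+1 w) <-> ((m %| n)%N -> C (X n w)).
  have -> : Q (prefix n.+1 w) = ((m %| (size (prefix n.+1 w)).-1)%N ->
    C (last 0%N (prefix n.+1 w))) by [].
  by rewrite size_prefix last_prefix.
have -> : L_ev (mstep m X) C = eventually_pre X Q; last exact: approximable_eventually.
apply/seteqP; split => [w [N wN]|w [N wN]].
  exists (N * m).+1 => -[//|n] Nn; apply/QE => /dvdnP[k kn].
  by rewrite kn; apply: wN; rewrite -(leq_pmul2r m0) -kn.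
exists N => n Nn; have /QE := wN (n * m).+1 ltac:(nia).
by apply; exact: dvdn_mull.
Qed.

(** Each of the [m] disjoint sets yields a harmonic function; at a high state they claim distinct
    residues of time, hence all of them. This gives the separation hypothesis of [prod_p_ge_exists]
    for the set of index 0. *)
Lemma beta_mstep_prod_p m : (2 < m)%N -> beta (mstep m X) = (m%:R)%:E ->
  exists2 c : R, 0 < c & forall i j, c <= \prod_(i <= k < j) p k.
Proof.
move=> m2; have m0 : (0 < m)%N by lia.
rewrite /beta /counting; set B := xget _ _.
case: asboolP => // finB [] /eqP; rewrite eqr_nat => /eqP cardB.
(* Without a decomposition, [xget] would return its default [set0], whose count is 0 and not [m]. *)
have BB : blackwell_decomposition (mstep m X) B.
  have [exB|/forallNP nB] := pselect (exists D, blackwell_decomposition (mstep m X) D).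
    exact: (@xgetPex _ set0 [set D | blackwell_decomposition (mstep m X) D] exB).
  have B0 : B = set0 by apply: xgetPN => D; exact: nB.
  by move: cardB m0; rewrite B0 fset_set0 => <-.
have [C [CB Cinj _]] : exists C, set_bij `I_m B C.
  apply/card_set_bijP; rewrite card_eq_sym.
  have /finite_setP[n Bn] := finB.
  by move: cardB; rewrite (card_fset_set Bn) => <-.
case: BB => _ dB acB _ _ _.
have Cdisj k l : (k < m)%N -> (l < m)%N -> k <> l -> C k `&` C l = set0.
  move=> km lm kl; apply: contrapT => /eqP/set0P kl0; apply: kl.
  by apply: Cinj; rewrite ?inE//; apply: dB => //; exact: CB.
have Cpos k : (k < m)%N -> 0 < pr (L_ev (mstep m X) (C k)).
  by move=> km; have /almost_closedP[] := acB _ (CB k km).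
have [h hP] := choice (fun k => harmonic_exists (C k) m0).
have h_mod k t t' i : t = t' %[mod m] -> h k t i = h k t' i.
  by apply: (@periodic_modn _ (h k ^~ i)) => s; case: (hP k).
(* A single good path in the event given by Levy's law suffices: it visits every state from [X n0 w]
   up, each time with conditional probability at least [1 - e] for [C k], which leaves at most [e]
   to any other set. *)
have sep1 (e : R) k : 0 < e -> (k < m)%N -> exists I, forall i, (I <= i)%N ->
    exists t, 1 - e <= h k t i /\ forall l, (l < m)%N -> k <> l -> h l t i <= e.
  move=> e0 km.
  have [D [n0 [mD DL D0 Dw]]] := levy (L_ev_mstep_approximable (C k) m0) (Cpos k km) e0.
  have [w [wD wg]] : exists w, (D `&` good) w.
    apply: (@pr_gt0_nonempty _ _ _ P).
    apply: lt_le_trans D0 _; apply: pr_null_le => //.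
      by apply: measurableI => //; exact: measurable_good.
    rewrite setDIr setDv set0U; apply/eqP; rewrite eq_le pr_ge0 andbT.
    have mgC : measurable (~` good) by exact/measurableC/measurable_good.
    rewrite -pr_setC_good; apply: pr_le => //.
    exact: (measurableD mD measurable_good).
  exists (X n0 w) => i /(good_visits wg)[t n0t <-]; exists t.
  have s0 : 0 < pr (cyl (prefix t.+1 w)) by case: wg => + _; exact.
  have hc l := let: And4 _ _ _ hl := hP l in hl t (prefix t.+1 w) (size_prefix _ _ _).
  have hk : 1 - e <= h k t (X t w).
    have := Dw w t.+1 wD (leqW n0t); rewrite hc last_prefix.
    by rewrite mulrC ler_pM2l.
  split => // l lm kl; suff : h k t (X t w) + h l t (X t w) <= 1 by lra.
  rewrite -(ler_pM2l s0) mulr1 mulrDr -!(last_prefix X 0%N) -!hc -pr_disj.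
  - apply: pr_le; [|exact: measurable_cyl|by move=> v [] []].
    by apply: measurableU; apply: measurableI;
      by [exact: measurable_L_ev|exact: measurable_cyl].
  - by apply: measurableI; [exact: measurable_L_ev|exact: measurable_cyl].
  - by apply: measurableI; [exact: measurable_L_ev|exact: measurable_cyl].
  - rewrite setIACA L_evI Cdisj//; apply/seteqP; split => // v [].
    by move=> /L_ev_set0.
have [hb hK hm _] := hP 0%N.
apply: (prod_p_ge_exists m2 hb hK hm) => e e0 e2.
have [J JP] := choice (fun k : 'I_m => sep1 e k e0 (ltn_ord k)).
exists (\max_(k < m) J k)%N => i Ji.
have ex k := JP k i (leq_trans (leq_bigmax _) Ji).
have [t tP] := choice ex.
(* Two sets cannot claim the same residue, since [1 - e > e]. So [g] is a bijection of the residues,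
   and any residue other than that of [t k0] belongs to another set and makes [h 0] at most [e]. *)
pose g (k : 'I_m) : 'I_m := Ordinal (ltn_pmod (t k) m0).
have ginj : injective g.
  move=> k l [] tkl; apply: contrapT => kl.
  have [_ /(_ l (ltn_ord l))] := tP k.
  move=> /(_ (fun kl' => kl (val_inj kl'))); rewrite (h_mod _ _ _ _ tkl).
  by have [] := tP l; lra.
pose k0 : 'I_m := Ordinal m0.
exists (t k0); split; first by case: (tP k0).
move=> t' t't; have /codomP[l gl] := injF_onto ginj (Ordinal (ltn_pmod t' m0)).
have tl : t' = t l %[mod m] by case: gl.
rewrite (h_mod _ _ _ _ tl); have [_ tPl] := tP l.
by apply: tPl => // l0; apply: t't; rewrite tl; congr (t _ %% _)%N; apply: val_inj.
Qed.

(** A single admissible [m > 2] bounds the products of the [p k] below, and then every [M] is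
    admissible. Otherwise the supremum runs over 1, always admissible, and possibly 2. *)
Lemma asymptotic_period_dichotomy :
  [\/ asymptotic_period X = 1%:E, asymptotic_period X = 2%:E
    | asymptotic_period X = +oo%E].
Proof.
rewrite /asymptotic_period; set S := mkset _.
have S1 : S 1%N by split => //; exact: beta_mstep1.
have le_sup m : S m -> ((m%:R)%:E <= ereal_sup [set (m%:R)%:E | m in S] :> \bar R)%E.
  by move=> Sm; apply: ereal_sup_ubound; exists m.
have [[m [m2 [_ Sm]]]|small] := pselect (exists m, (2 < m)%N /\ S m).
  have [c c0 cP] := beta_mstep_prod_p m2 Sm.
  constructor 3; apply/eqyP => x x0.
  pose M := (Num.truncn x).+1.
  have SM : S M by split => //; exact: (beta_mstep_climb c0 cP).
  by apply: le_trans (le_sup M SM); rewrite lee_fin ltW// truncnS_gt.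
have S_le m : S m -> (m <= 2)%N.
  by move=> Sm; rewrite leqNgt; apply/negP => m2; apply: small; exists m.
have [S2|nS2] := pselect (S 2%N).
  constructor 2; apply/le_anti; rewrite (le_sup _ S2) andbT.
  by apply: ub_ereal_sup => _ [m Sm <-]; rewrite lee_fin ler_nat S_le.
constructor 1; apply/le_anti; rewrite (le_sup _ S1) andbT.
apply: ub_ereal_sup => _ [m Sm <-]; rewrite lee_fin (ler_nat R m 1).
have := S_le _ Sm; rewrite leq_eqVlt => /predU1P[m2|//].
by case: nS2; rewrite -m2.
Qed.

End loop.

End birth_death_chain.

Theorem theorem10 (d : measure_display) (T : measurableType d) (R : realType)
    (P : probability T R) (X : nat -> {RV P >-> nat}) (p q r : nat -> R)
    (p_gt0 : forall i, 0 < p i)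
    (q0 : q 0%N = 0)
    (q_gt0 : forall i, 0 < q i.+1)
    (r_ge0 : forall i, 0 <= r i)
    (pqr1 : forall i, p i + q i + r i = 1)
    (r_neq0 : exists i, 0 < r i)
    (X_bd : markov_chain (birth_death p q r) X) :
  [\/ asymptotic_period X = 1%:E,
      asymptotic_period X = 2%:E
    | asymptotic_period X = +oo%E].
Proof.
have [a ra] := r_neq0.
exact: (asymptotic_period_dichotomy p_gt0 q0 q_gt0 r_ge0 pqr1 X_bd ra).
Qed.
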